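(* Let $a\in\mathbb{Z}$ and $p\ge1$, and suppose that either $a\ge1$ and $p=1$, or $a\ge2$ and $p>1$. Let $T:\ell^p(\mathbb{Z},\omega_a)\to\ell^p(\mathbb{Z},\omega_a)$ be an algebra isomorphism. Then $T$ can be extended to a continuous operator on $\ell^p(\mathbb{Z})$, and this extension is a linear isomorphism of $\ell^p(\mathbb{Z})$.
   Context: For $a\ge0$, $\omega_a(n)=\max(1,|n|^a)$, $n\in\mathbb{Z}$. $\ell^p(\mathbb{Z},\omega_a)$ is the space of sequences $f=(f_n)_{n\in\mathbb{Z}}$ with $\sum_n|f_n|^p\omega_a(n)^p<\infty$, normed by $\left(\sum_n|f_n|^p\omega_a(n)^p\right)^{1/p}$; under the given hypotheses it is an algebra under convolution, and $\ell^p(\mathbb{Z},\omega_a)\subset\ell^p(\mathbb{Z})$. *)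

(* Defs.v *)
From HB Require Import structures.
From mathcomp Require Import all_boot all_order all_algebra.
From mathcomp Require Import all_classical all_reals all_analysis.
From mathcomp Require Import complex.
Set Implicit Arguments. Unset Strict Implicit. Unset Printing Implicit Defensive.
Import Order.TTheory GRing.Theory Num.Theory.
Import numFieldNormedType.Exports.
Local Open Scope ring_scope.
Local Open Scope classical_set_scope.

Definition cmod {R : realType} (z : R[i]) : R := ComplexField.Normc.normc z.

Definition omega {R : realType} (a : R) (n : int) : R :=
  Num.max 1 ((`|n|%:~R : R) `^ a).

Definition lpw_sum {R : realType} (p a : R) (f : int -> R[i]) : \bar R :=
  \esum_(n in [set: int]) ((cmod (f n) * omega a n) `^ p)%:E.

Definition in_lpw {R : realType} (p a : R) (f : int -> R[i]) : Prop :=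
  (lpw_sum p a f < +oo)%E.

Definition lp_sum {R : realType} (p : R) (f : int -> R[i]) : \bar R :=
  \esum_(n in [set: int]) ((cmod (f n)) `^ p)%:E.

Definition in_lp {R : realType} (p : R) (f : int -> R[i]) : Prop :=
  (lp_sum p f < +oo)%E.

(* the l^p(Z) norm (meaningful when in_lp p f) *)
Definition lp_norm {R : realType} (p : R) (f : int -> R[i]) : R :=
  (fine (lp_sum p f)) `^ (p^-1).

Definition zpsum {R : realType} (u : int -> R[i]) (N : nat) : R[i] :=
  \sum_(k < (N + N).+1) u (k%:Z - N%:Z).

Definition zsum {R : realType} (u : int -> R[i]) : R[i] :=
  Complex (limn (fun N => (complex.Re (zpsum u N) : R)))
          (limn (fun N => (complex.Im (zpsum u N) : R))).

Definition conv {R : realType} (f g : int -> R[i]) : int -> R[i] :=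
  fun n => zsum (fun k => f k * g (n - k)).

Definition alg_iso_lpw {R : realType} (p a : R)
    (T : (int -> R[i]) -> (int -> R[i])) : Prop :=
  [/\ (forall f, in_lpw p a f -> in_lpw p a (T f)),
      (forall (c : R[i]) f g, in_lpw p a f -> in_lpw p a g ->
         T (fun n => c * f n + g n) = (fun n => c * T f n + T g n)),
      (forall f g, in_lpw p a f -> in_lpw p a g ->
         T (conv f g) = conv (T f) (T g)),
      (forall f g, in_lpw p a f -> in_lpw p a g -> T f = T g -> f = g) &
      (forall h, in_lpw p a h -> exists2 f, in_lpw p a f & T f = h)].

Definition lin_iso_lp {R : realType} (p : R)
    (S : (int -> R[i]) -> (int -> R[i])) : Prop :=
  [/\ (forall f, in_lp p f -> in_lp p (S f)),
      (forall (c : R[i]) f g, in_lp p f -> in_lp p g ->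
         S (fun n => c * f n + g n) = (fun n => c * S f n + S g n)),
      (exists C : R, forall f, in_lp p f -> lp_norm p (S f) <= C * lp_norm p f),
      (forall f g, in_lp p f -> in_lp p g -> S f = S g -> f = g) &
      (forall h, in_lp p h -> exists2 f, in_lp p f & S f = h) /\
      (exists C : R, forall f, in_lp p f -> lp_norm p f <= C * lp_norm p (S f))].

(* Main.v *)
From Pilot Require Import Defs.
From HB Require Import structures.
From mathcomp Require Import all_boot all_order all_algebra.
From mathcomp Require Import all_classical all_reals all_analysis.
From mathcomp Require Import complex finmap.
From mathcomp Require Import showcase.summability.
From mathcomp Require Import ring lra zify.
Set Implicit Arguments. Unset Strict Implicit. Unset Printing Implicit Defensive.
Import Order.TTheory GRing.Theory Num.Theory.
Import numFieldNormedType.Exports Pilot.Defs.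
Local Open Scope classical_set_scope.
Local Open Scope ring_scope.

(** Write [D f n = n f(n)] for the derivation of the convolution algebra and
    [chi_z f = \sum_n f(n) z^n] for [|z| = 1]; the characters [chi_z] determine the
    coefficients.

    [T] is bounded on [A = l^p(Z, omega_a)]: the characters [chi_z o T] of [A] are
    uniformly bounded, hence so are the coefficients of [T f], and the uniform
    boundedness principle applies.

    For finitely supported [g], [chi_z (D (T g)) = c_z chi_z (T (D g))] with [c_z]
    independent of [g], whence [T (D f) * D (T g) = D (T f) * T (D g)].  Approximating
    the preimage of [delta 1] yields finitely supported [q] with [D (T q)] close to
    [delta 1] in [l^p(Z, omega_(a-1))].  Suppose that [T] is bounded on finitely
    supported sequences for the weight [omega_(b+1)].  Then
    [delta 1 * T (D g) = T (D q) * D (T g) + r * T (D g)] with [r] small: as convolution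
    with [delta 1] is a shift, absorbing the last term bounds [T (D g)] for the weight
    [omega_b], and every [f] with [f 0 = 0] is some [D g].  After [a] steps [T] is bounded
    for the norm of [l^p(Z)] and extends by density; so does its inverse. *)

(** * Complex limits and unordered sums *)

Lemma ler_mul_divD1 (R : realFieldType) (c e : R) : 0 <= c -> 0 <= e ->
  c * (e / (c + 1)) <= e.
Proof.
move=> c0 e0; rewrite mulrCA ler_piMr// ler_pdivrMr ?ltr_wpDl//.
by rewrite mul1r lerDl.
Qed.

Section ComplexModulus.
Variable R : realType.
Implicit Types (x y z : R[i]) (t : R).

Lemma cmod_ge0 z : 0 <= cmod z.
Proof. by case: z => a b; rewrite /cmod /= sqrtr_ge0. Qed.

Lemma cmod0 : cmod (0 : R[i]) = 0.
Proof. exact: ComplexField.Normc.normc0. Qed.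

Lemma cmod1 : cmod (1 : R[i]) = 1.
Proof. exact: ComplexField.Normc.normc1. Qed.

Lemma cmod_eq0 z : cmod z = 0 -> z = 0.
Proof. exact: ComplexField.Normc.eq0_normc. Qed.

Lemma cmod_gt0 z : (0 < cmod z) = (z != 0).
Proof.
rewrite lt0r cmod_ge0 andbT; congr negb.
by apply/eqP/eqP => [/cmod_eq0|->]; rewrite ?cmod0.
Qed.

Lemma cmodM x y : cmod (x * y) = cmod x * cmod y.
Proof. exact: ComplexField.Normc.normcM. Qed.

Lemma cmodV z : cmod z^-1 = (cmod z)^-1.
Proof. exact: ComplexField.Normc.normcV. Qed.

Lemma normr_cmod z : `|z| = (cmod z)%:C%C.
Proof. by []. Qed.

Lemma ler_cmodD x y : cmod (x + y) <= cmod x + cmod y.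
Proof. exact: le_normcD. Qed.

Lemma cmodN z : cmod (- z) = cmod z.
Proof. exact: normcN. Qed.

Lemma ler_cmodB x y : cmod (x - y) <= cmod x + cmod y.
Proof. by rewrite -(cmodN y) ler_cmodD. Qed.

Lemma cmod_distC x y : cmod (x - y) = cmod (y - x).
Proof. by rewrite -cmodN opprB. Qed.

Lemma cmod_real t : cmod t%:C%C = `|t|.
Proof. by rewrite /cmod /= expr0n addr0 sqrtr_sqr. Qed.

Lemma cmod_int (n : int) : cmod (n%:~R : R[i]) = `|n|%:~R.
Proof. by rewrite -[n%:~R](rmorph_int (real_complex R)) cmod_real intr_norm. Qed.

Lemma cmod_exprz z (n : int) : cmod (z ^ n) = cmod z ^ n.
Proof.
have cmodX m : cmod (z ^+ m) = cmod z ^+ m.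
  by elim: m => [|m IHm]; rewrite ?cmod1// !exprS cmodM IHm.
by case: n => m; rewrite ?NegzE -?exprnN ?exprnN ?cmodV cmodX.
Qed.

Lemma ler_cmod_sum (I : Type) (r : seq I) (F : I -> R[i]) :
  cmod (\sum_(i <- r) F i) <= \sum_(i <- r) cmod (F i).
Proof.
elim/big_ind2: _ => [|x s y t xs yt|//]; first by rewrite cmod0.
exact: le_trans (ler_cmodD _ _) (lerD xs yt).
Qed.

Lemma cmod_Re z : `|complex.Re z| <= cmod z.
Proof.
by case: z => a b /=; rewrite /cmod /= -sqrtr_sqr ler_wsqrtr// lerDl sqr_ge0.
Qed.

Lemma cmod_Im z : `|complex.Im z| <= cmod z.
Proof.
by case: z => a b /=; rewrite /cmod /= -sqrtr_sqr ler_wsqrtr// lerDr sqr_ge0.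
Qed.

Lemma cmod_le_ReIm z : cmod z <= `|complex.Re z| + `|complex.Im z|.
Proof.
have cmod_i : cmod ('i%C : R[i]) = 1.
  by rewrite /cmod /= expr0n expr1n add0r sqrtr1.
rewrite [X in cmod X]complexE (le_trans (ler_cmodD _ _))//.
by rewrite cmodM cmod_i mul1r !cmod_real.
Qed.

End ComplexModulus.

(* [R[i]^o] carries the topology of the modulus as a field normed by itself. *)
HB.lock Definition ccvg {R : realType} {T : Type} (F : set_system T) (u : T -> R[i])
    (l : R[i]) : Prop :=
  (u x : R[i]^o) @[x --> F] --> (l : R[i]^o).

Section ComplexConvergence.
Variables (R : realType) (T : Type) (F : set_system T).
Context {FF : ProperFilter F}.
Implicit Types (u v : T -> R[i]) (l m : R[i]).

Lemma ccvgP u l : ccvg F u l <->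
  forall e : R, 0 < e -> \forall x \near F, cmod (u x - l) <= e.
Proof.
rewrite ccvg.unlock; split=> [/cvgrPdist_le ul e e0|ul].
  have /ul : 0 < e%:C%C :> R[i] by rewrite ltcR.
  by apply: filterS => x; rewrite distrC normr_cmod lecR.
apply/cvgrPdist_le => e e0.
have /complex_realP[t et] : e \is Num.real by rewrite gtr0_real.
move: e0; rewrite et ltcR => /ul; apply: filterS => x.
by rewrite distrC normr_cmod lecR.
Qed.

Lemma ccvg_unique u l m : ccvg F u l -> ccvg F u m -> l = m.
Proof. by rewrite ccvg.unlock => /cvg_unique; apply; exact: norm_hausdorff. Qed.

Lemma ccvgD u v l m : ccvg F u l -> ccvg F v m ->
  ccvg F (fun x => u x + v x) (l + m).
Proof. by rewrite ccvg.unlock; exact: cvgD. Qed.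

Lemma ccvgZ (c : R[i]) u l : ccvg F u l -> ccvg F (fun x => c * u x) (c * l).
Proof. by rewrite ccvg.unlock; exact: cvgMr. Qed.

Lemma ccvg_cst l : ccvg F (fun=> l) l.
Proof. by rewrite ccvg.unlock; exact: cvg_cst. Qed.

Lemma ccvg_Re u l : ccvg F u l -> (complex.Re (u x) @[x --> F] --> complex.Re l)%classic.
Proof.
move=> /ccvgP ul; apply/cvgrPdist_le => e /ul; apply: filterS => x; apply: le_trans.
by rewrite distrC -raddfB cmod_Re.
Qed.

Lemma ccvg_Im u l : ccvg F u l -> (complex.Im (u x) @[x --> F] --> complex.Im l)%classic.
Proof.
move=> /ccvgP ul; apply/cvgrPdist_le => e /ul; apply: filterS => x; apply: le_trans.
by rewrite distrC -raddfB cmod_Im.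
Qed.

Lemma ccvg_cauchy u :
  (forall e : R, 0 < e -> exists z, \forall x \near F, cmod (u x - z) <= e) ->
  exists l, ccvg F u l.
Proof.
move=> cauchy_u.
have cvg_part (r : R[i] -> R) : (forall y z, `|r y - r z| <= cmod (y - z)) ->
    cvg (r (u x) @[x --> F]).
  move=> r_lip; apply/cauchy_cvgP/cauchy_exP => e e0.
  have [|z uz] := cauchy_u (e / 2); first by rewrite divr_gt0.
  exists (r z); apply: filterS uz => x uxz.
  rewrite /ball /= distrC (le_lt_trans (r_lip _ _))// (le_lt_trans uxz)//.
  by rewrite ltr_pdivrMr// mulr_natr mulr2n ltrDl.
have [y z|a /cvgrPdist_le ua] := (cvg_ex _).1 (cvg_part (@complex.Re R) _).
  by rewrite -raddfB cmod_Re.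
have [y z|b /cvgrPdist_le ub] := (cvg_ex _).1 (cvg_part (@complex.Im R) _).
  by rewrite -raddfB cmod_Im.
exists (Complex a b); apply/ccvgP => e e0.
have e20 : 0 < e / 2 by rewrite divr_gt0.
apply: filterS2 (ua _ e20) (ub _ e20) => x uax ubx.
by rewrite (le_trans (cmod_le_ReIm _))// (splitr e) !raddfB lerD 1?distrC.
Qed.

Lemma ccvg_cmod_le u l (B : R) : ccvg F u l ->
  (\forall x \near F, cmod (u x) <= B) -> cmod l <= B.
Proof.
move=> /ccvgP ul uB; apply/ler_addgt0Pr => e /ul ule.
have [x [uxB uxl]] := filter_ex (filterI uB ule).
by rewrite -[l](subKr (u x)) (le_trans (ler_cmodB _ _))// lerD.
Qed.

End ComplexConvergence.

Lemma ccvg_comp (R : realType) (T U : Type) (F : set_system T) (G : set_system U)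
    (h : T -> U) (u : U -> R[i]) (l : R[i]) :
  h @ F --> G -> ccvg G u l -> ccvg F (u \o h) l.
Proof. by rewrite ccvg.unlock; exact: cvg_comp. Qed.

Definition win (N : nat) : {fset int} :=
  [fset (nat_of_ord k)%:Z - N%:Z | k in 'I_(N + N).+1]%fset.

Lemma mem_win (n : int) N : (n \in win N) = (`|n| <= N)%N.
Proof.
apply/imfsetP/idP => [[k _ ->]|nN]; first by have := ltn_ord k; lia.
have nN_lt : (absz (n + N%:Z)%R < (N + N).+1)%N by lia.
by exists (Ordinal nN_lt) => //=; lia.
Qed.

Lemma big_win (V : nmodType) (u : int -> V) N :
  \sum_(n <- win N) u n = \sum_(k < (N + N).+1) u (k%:Z - N%:Z).
Proof.
rewrite big_imfset /=; last by move=> i j _ _ ij; apply: val_inj => /=; lia.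
by rewrite big_enum.
Qed.

Lemma big_win0 (V : nmodType) (u : int -> V) : \sum_(n <- win 0) u n = u 0.
Proof. by rewrite big_win big_ord1. Qed.

Lemma big_winS (V : nmodType) (u : int -> V) N :
  \sum_(n <- win N.+1) u n = u (- N.+1%:Z) + \sum_(n <- win N) u n + u N.+1%:Z.
Proof.
rewrite !big_win addSn addnS big_ord_recl big_ord_recr /= addrA.
congr (_ + _ + _).
- by congr u; lia.
- by apply: eq_bigr => k _; congr u; rewrite /bump /=; lia.
- by congr u; rewrite /bump /=; lia.
Qed.

Lemma fsub_win (A : {fset int}) : \forall N \near \oo, (A `<=` win N)%fset.
Proof.
exists (\max_(n <- A) `|n|)%N => //= N AN; apply/fsubsetP => n nA.
by rewrite mem_win (leq_trans _ AN)// (big_fsetD1 n)//= leq_maxl.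
Qed.

Lemma cvg_win : win @ \oo --> totally.
Proof. by move=> P [A _ AP]; apply: filterS (fsub_win A) => N; exact: AP. Qed.

Lemma sum_fsubset (V : nmodType) (I : choiceType) (F : I -> V) (A B : {fset I}) :
  (A `<=` B)%fset ->
  \sum_(i <- B) F i = \sum_(i <- A) F i + \sum_(i <- (B `\` A)%fset) F i.
Proof.
move=> AB; rewrite (big_fsetID _ (mem A)) /=; congr (_ + _).
  rewrite (_ : [fset i in B | i \in A]%fset = A)//; apply/fsetP => i.
  by rewrite !inE /= andbC; case: (boolP (i \in A)) => // /(fsubsetP AB).
by congr bigop; congr enum_fset; apply/fsetP => i; rewrite !inE /= andbC.
Qed.

Lemma ler_sum_fsub (R : numDomainType) (I : choiceType) (F : I -> R)
    (A B : {fset I}) :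
  (forall i, 0 <= F i) -> (A `<=` B)%fset ->
  \sum_(i <- A) F i <= \sum_(i <- B) F i.
Proof.
by move=> F0 /sum_fsubset ->; rewrite lerDl sumr_ge0.
Qed.

Lemma sum_nneg_tail (R : realType) (I : choiceType) (v : I -> R) (B : R) :
  (forall i, 0 <= v i) -> (forall A : {fset I}, \sum_(i <- A) v i <= B) ->
  forall e, 0 < e -> exists A : {fset I}, forall D : {fset I},
    [disjoint A & D]%fset -> \sum_(i <- D) v i <= e.
Proof.
move=> v0 vB e e0; pose S := [set \sum_(i <- A) v i | A in [set: {fset I}]].
have supS : has_sup S.
  by split; [exists (\sum_(i <- fset0) v i), fset0|exists B => _ [A _ <-]].
have [_ [A _ <-] /ltW supA] := sup_adherent e0 supS; exists A => D AD.
have : \sum_(i <- (A `|` D)%fset) v i <= sup S.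
  by apply: sup_upper_bound => //; exists (A `|` D)%fset.
rewrite (sum_fsubset _ (fsubsetUl A D)) fsetDUl fsetDv fset0U.
rewrite fdisjoint_sym in AD; rewrite (fsetDidPl _ _ AD).
by move: supA; rewrite lerBlDr => supA /le_trans/(_ supA); rewrite lerD2l.
Qed.

Definition has_sum {R : realType} {I : choiceType} (u : I -> R[i]) (l : R[i]) :=
  ccvg totally (fun A : {fset I} => \sum_(i <- A) u i) l.

Section UnorderedSums.
Variables (R : realType) (I : choiceType).
Implicit Types (u v : I -> R[i]) (l m : R[i]) (A : {fset I}) (B : R).
#[local] Existing Instance totally_filter.

Lemma near_totally (P : {fset I} -> Prop) A :
  (forall D, (A `<=` D)%fset -> P D) -> \forall D \near totally, P D.
Proof. by move=> AP; exists A. Qed.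

Lemma has_sum_unique u l m : has_sum u l -> has_sum u m -> l = m.
Proof. exact: ccvg_unique. Qed.

Lemma has_sumZD (c : R[i]) u v l m : has_sum u l -> has_sum v m ->
  has_sum (c \*o u + v) (c * l + m).
Proof.
move=> ul vm; rewrite /has_sum (_ : (fun A => _) =
  fun A => c * \sum_(i <- A) u i + \sum_(i <- A) v i).
  exact: ccvgD (ccvgZ c ul) vm.
by apply/funext => A; rewrite big_split /= -mulr_sumr.
Qed.

Lemma has_sum_finite u A : (forall i, i \notin A -> u i = 0) ->
  has_sum u (\sum_(i <- A) u i).
Proof.
move=> uA0; apply/ccvgP => e e0; apply: (@near_totally _ A) => D AD.
by rewrite -(big_fset_incl _ AD) ?subrr ?cmod0 ?ltW// => i _; exact: uA0.
Qed.

Lemma has_sumZ (c : R[i]) u l : has_sum u l -> has_sum (c \*o u) (c * l).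
Proof.
move=> ul; have zero : has_sum (0 : I -> R[i]) 0.
  by have := @has_sum_finite 0 fset0 (fun _ _ => erefl); rewrite big_seq_fset0.
by have := has_sumZD c ul zero; rewrite !addr0.
Qed.

Lemma has_sum_exists u B : (forall A, \sum_(i <- A) cmod (u i) <= B) ->
  exists l, has_sum u l.
Proof.
move=> uB; apply: ccvg_cauchy => e /(sum_nneg_tail (fun i => cmod_ge0 (u i)) uB)[A tailA].
exists (\sum_(i <- A) u i); apply: (@near_totally _ A) => D AD.
rewrite (sum_fsubset _ AD) addrAC subrr add0r (le_trans (ler_cmod_sum _ _))// tailA//.
by apply/fdisjointP => i iA; rewrite inE iA.
Qed.

Lemma has_sum_cmod_le u l B : has_sum u l ->
  (forall A, \sum_(i <- A) cmod (u i) <= B) -> cmod l <= B.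
Proof.
move=> ul uB; apply: (ccvg_cmod_le ul); apply: (@near_totally _ fset0) => A _.
exact: le_trans (ler_cmod_sum _ _) (uB A).
Qed.

Lemma sum_le_has_sum (v : I -> R) l A : (forall i, 0 <= v i) ->
  has_sum (fun i => (v i)%:C%C) l -> \sum_(i <- A) v i <= cmod l.
Proof.
move=> v0 /ccvgP vl; apply/ler_addgt0Pr => e /vl[D _ vD].
have /= := vD (A `|` D)%fset (fsubsetUr A D).
set s := \sum_(i <- _) _ => sl.
apply: (@le_trans _ _ (cmod s)).
  rewrite /s -rmorph_sum cmod_real ger0_norm ?sumr_ge0//.
  exact: ler_sum_fsub v0 (fsubsetUl A D).
by rewrite -[s](subrK l) addrC (le_trans (ler_cmodD _ _))// lerD2l.
Qed.

Lemma has_sum_reindex (J : choiceType) (h : J -> I) (g : I -> J) u l :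
  cancel g h -> cancel h g -> has_sum u l -> has_sum (u \o h) l.
Proof.
move=> gK hK /ccvgP ul; apply/ccvgP => e /ul[A _ uA].
exists [fset g i | i in A]%fset => //= D gAD.
have := uA [fset h j | j in D]%fset; rewrite big_imfset/=; last first.
  by move=> i j _ _; apply: (can_inj hK).
apply; apply/fsubsetP => i iA; apply/imfsetP; exists (g i); rewrite ?gK//.
by apply: (fsubsetP gAD); apply/imfsetP; exists i.
Qed.

End UnorderedSums.

Lemma has_sum_zsum (R : realType) (u : int -> R[i]) l : has_sum u l -> zsum u = l.
Proof.
have zpsum_win N : zpsum u N = \sum_(n <- win N) u n by rewrite big_win.
move=> ul; have {ul} : ccvg \oo (zpsum u) l.
  by rewrite (funext zpsum_win); exact: ccvg_comp cvg_win ul.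
move=> ul; rewrite /zsum (cvg_lim _ (ccvg_Re ul))// (cvg_lim _ (ccvg_Im ul))//.
by case: l ul.
Qed.

(** * Finite l^p norms *)

(* [0 <= x] is assumed throughout: [x `^ p] only sees [ln x], not the sign of [x]. *)
Definition pnorm {R : realType} {I : choiceType} (p : R) (A : {fset I})
    (x : I -> R) : R :=
  (\sum_(i <- A) x i `^ p) `^ p^-1.

Section FiniteSums.
Variables (R : realType) (I : choiceType) (p : R).
Hypothesis p_gt0 : 0 < p.
Implicit Types (x y : I -> R) (A : {fset I}).

Let p_neq0 : p != 0. Proof. exact: lt0r_neq0. Qed.

Lemma pnorm_ge0 A x : 0 <= pnorm p A x.
Proof. exact: powR_ge0. Qed.

Lemma powRVK (a : R) : 0 <= a -> (a `^ p^-1) `^ p = a.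
Proof. by move=> a0; rewrite -powRrM mulVf// powRr1. Qed.

Lemma powRKV (a : R) : 0 <= a -> (a `^ p) `^ p^-1 = a.
Proof. by move=> a0; rewrite -powRrM divff// powRr1. Qed.

Lemma pnorm_le A x (s : R) : 0 <= s ->
  (pnorm p A x <= s) = (\sum_(i <- A) x i `^ p <= s `^ p).
Proof.
move=> s0; have sum0 : 0 <= \sum_(i <- A) x i `^ p.
  by apply: sumr_ge0 => i _; exact: powR_ge0.
apply/idP/idP => [xs|xs].
  by rewrite -[leLHS]powRVK// ge0_ler_powR ?nnegrE ?pnorm_ge0// ltW.
rewrite -[leRHS]powRKV// ge0_ler_powR ?nnegrE ?powR_ge0//.
by rewrite invr_ge0 ltW.
Qed.

Lemma ler_pnorm A x y : (forall i, i \in A -> 0 <= x i <= y i) ->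
  pnorm p A x <= pnorm p A y.
Proof.
move=> xy; rewrite pnorm_le ?pnorm_ge0// powRVK; last first.
  by apply: sumr_ge0 => i _; exact: powR_ge0.
rewrite big_seq [leRHS]big_seq; apply: ler_sum => i /xy /andP[x0 xyi].
by rewrite ge0_ler_powR ?nnegrE ?(ltW p_gt0)// (le_trans x0).
Qed.

Lemma pnorm_cst A (c : R) : 0 <= c ->
  pnorm p A (fun=> c) = #|` A|%:R `^ p^-1 * c.
Proof.
move=> c0; rewrite /pnorm big_const_seq count_predT iter_addr addr0.
by rewrite -[X in X `^ _]mulr_natl powRM ?powR_ge0 ?powRKV.
Qed.

Lemma pnormZ A x (c : R) : 0 <= c -> (forall i, 0 <= x i) ->
  pnorm p A (fun i => c * x i) = c * pnorm p A x.
Proof.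
move=> c0 x0; rewrite /pnorm; under eq_bigr do rewrite powRM//.
rewrite -mulr_sumr powRM ?powR_ge0 ?powRKV// sumr_ge0// => i _.
exact: powR_ge0.
Qed.

Lemma pnorm_fset1 (i : I) x : 0 <= x i -> pnorm p [fset i]%fset x = x i.
Proof. by move=> xi0; rewrite /pnorm big_seq_fset1 powRKV. Qed.

Let seq_fun A x (k : nat) : R := nth 0 [seq x i | i <- A] k.

Let seq_funE (op : R -> R -> R) A x y : op 0 0 = 0 ->
  seq_fun A (fun i => op (x i) (y i)) = (fun k => op (seq_fun A x k) (seq_fun A y k)).
Proof.
move=> op00; apply/funext; rewrite /seq_fun.
by elim: (enum_fset A) => [|i r IHr] [|k] //=; rewrite ?nth_nil ?op00.
Qed.

Let pnorm_Lnorm (q : R) A x : 0 < q -> (forall i, 0 <= x i) ->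
  'N[counting]_q%:E [EFin \o seq_fun A x]%E = (pnorm q A x)%:E.
Proof.
move=> q0 x0; rewrite Lnorm_counting// (nneseries_split 0 #|` A|); last first.
  by move=> k _; exact: poweR_ge0.
rewrite [X in (_ + X)%E]eseries0 ?adde0 => [|k Ak _ /=]; last first.
  by rewrite /seq_fun nth_default ?size_map// normr0 powR0// gt_eqF.
rewrite /= sumEFin poweR_EFin /pnorm add0n; congr (_ `^ _)%:E.
rewrite -[RHS](big_map x predT (fun a => a `^ q)) [RHS](big_nth 0) size_map.
apply: eq_big_nat => k /andP[_ kA]; rewrite ger0_norm//.
by apply: (all_nthP 0 _); rewrite ?size_map// all_map; apply/allP => i _ /=.
Qed.

Let measurable_seq_fun A x : measurable_fun setT (seq_fun A x). Proof. by []. Qed.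

Lemma ler_pnormD A x y : 1 <= p -> (forall i, 0 <= x i) -> (forall i, 0 <= y i) ->
  pnorm p A (fun i => x i + y i) <= pnorm p A x + pnorm p A y.
Proof.
move=> p1 x0 y0; have := minkowski_EFin counting
  (measurable_seq_fun A x) (measurable_seq_fun A y) p1.
rewrite -[_ \+ _]/(fun k => _ + _) -(seq_funE _ _ _ (addr0 0)).
by rewrite !pnorm_Lnorm// => i; exact: addr_ge0.
Qed.

Lemma sumM_le_pnorm (q : R) A x y : 0 < q -> p^-1 + q^-1 = 1 ->
  (forall i, 0 <= x i) -> (forall i, 0 <= y i) ->
  \sum_(i <- A) x i * y i <= pnorm p A x * pnorm q A y.
Proof.
move=> q0 pq x0 y0; have := hoelder counting
  (measurable_seq_fun A x) (measurable_seq_fun A y) p_gt0 q0 pq.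
rewrite -[_ \* _]/(fun k => _ * _) -(seq_funE _ _ _ (mulr0 0)).
rewrite !pnorm_Lnorm// => [|i]; last exact: mulr_ge0.
rewrite -EFinM lee_fin /pnorm invr1 powRr1.
  by under eq_bigr do rewrite powRr1 ?mulr_ge0//.
by apply: sumr_ge0 => i _; exact: powR_ge0.
Qed.

End FiniteSums.

Lemma pnorm1E (R : realType) (I : choiceType) (A : {fset I}) (x : I -> R) :
  (forall i, 0 <= x i) -> pnorm 1 A x = \sum_(i <- A) x i.
Proof.
move=> x0; rewrite /pnorm invr1 powRr1; last by apply: sumr_ge0 => i _; exact: powR_ge0.
by under eq_bigr do rewrite powRr1//.
Qed.

(** * Weighted l^p spaces *)

(* [lpball p w s] is the closed ball of radius [s] of [l^p(I, w)], centred at [0];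
   carrying the radius as an index spares the norm as a partial function. *)
HB.lock Definition lpball {R : realType} {I : choiceType} (p : R) (w : I -> R) (s : R)
    (f : I -> R[i]) : Prop :=
  forall A : {fset I}, pnorm p A (fun i => cmod (f i) * w i) <= s.

Lemma lpball_pnormP (R : realType) (I : choiceType) (p : R) (w : I -> R) s f :
  lpball p w s f <-> forall A : {fset I}, pnorm p A (fun i => cmod (f i) * w i) <= s.
Proof. by rewrite lpball.unlock. Qed.

Definition lpw {R : realType} {I : choiceType} (p : R) (w : I -> R)
    (f : I -> R[i]) : Prop :=
  exists s, lpball p w s f.

Definition lpcvg {R : realType} {I : choiceType} (p : R) (w : I -> R) {T : Type}
    (F : set_system T) (u : T -> I -> R[i]) (f : I -> R[i]) : Prop :=
  forall e : R, 0 < e -> \forall x \near F, lpball p w e (u x - f).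

Definition delta {R : realType} {I : choiceType} (i j : I) : R[i] := (j == i)%:R.

Definition trunc {R : realType} {I : choiceType} (A : {fset I}) (f : I -> R[i])
    (i : I) : R[i] :=
  if i \in A then f i else 0.

Definition finsupp {R : realType} {I : choiceType} (f : I -> R[i]) : Prop :=
  exists A : {fset I}, f = trunc A f.

Lemma mul1_fun (R : pzRingType) (T : Type) (f : T -> R) : 1 \*o f = f.
Proof. by apply/funext => x /=; rewrite mul1r. Qed.

Lemma mulN1_fun (R : pzRingType) (T : Type) (f : T -> R) : -1 \*o f = - f.
Proof. by apply/funext => x /=; rewrite mulN1r. Qed.

Section FiniteSupport.
Variables (R : realType) (I : choiceType).
Implicit Types (f g : I -> R[i]) (A : {fset I}).

Lemma truncE A f i : i \in A -> trunc A f i = f i.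
Proof. by rewrite /trunc => ->. Qed.

Lemma trunc_notin A f i : i \notin A -> trunc A f i = 0.
Proof. by rewrite /trunc => /negbTE ->. Qed.

Lemma finsupp_trunc A f : finsupp (trunc A f).
Proof. by exists A; apply/funext => i; rewrite /trunc; case: ifP. Qed.

Lemma finsupp_delta i : finsupp (@delta R I i).
Proof.
exists [fset i]%fset; apply/funext => j; rewrite /trunc /delta inE.
by case: eqVneq.
Qed.

Lemma finsupp0 : finsupp (0 : I -> R[i]).
Proof. by exists fset0; apply/funext => i; rewrite trunc_notin. Qed.

Lemma finsuppZD (c : R[i]) f g : finsupp f -> finsupp g -> finsupp (c \*o f + g).
Proof.
move=> [A fA] [B gB]; exists (A `|` B)%fset; apply/funext => i; rewrite /trunc inE.
case: ifPn; rewrite // negb_or => /andP[iA iB].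
by rewrite fctE /= fA gB !trunc_notin// mulr0 addr0.
Qed.

Lemma finsuppB f g : finsupp f -> finsupp g -> finsupp (f - g).
Proof. by move=> fin_f fin_g; rewrite addrC -mulN1_fun; exact: finsuppZD. Qed.

Lemma finsupp_ind (P : (I -> R[i]) -> Prop) : P 0 ->
  (forall c i f, finsupp f -> P f -> P (c \*o delta i + f)) ->
  forall f, finsupp f -> P f.
Proof.
move=> P0 PD f [A ->]; elim/finSet_rect: A => A IHA.
have [->|[i iA]] := fset_0Vmem A.
  by rewrite (_ : trunc _ _ = 0)//; apply/funext => i; rewrite trunc_notin.
rewrite (_ : trunc A f = f i \*o delta i + trunc (A `\ i)%fset f).
  apply: PD; first exact: finsupp_trunc.
  by apply: IHA; rewrite fproperD1.
apply/funext => j; rewrite /trunc /delta fctE /= !inE.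
have [->|ji] /= := eqVneq j i; first by rewrite iA mulr1 addr0.
by rewrite mulr0 add0r.
Qed.

End FiniteSupport.

Section WeightedLp.
Variables (R : realType) (I : choiceType) (p : R) (w : I -> R).
Hypotheses (p_ge1 : 1 <= p) (w_gt0 : forall i, 0 < w i).
Implicit Types (f g : I -> R[i]) (s t : R) (A : {fset I}).
#[local] Existing Instance totally_filter.

Let p_gt0 : 0 < p. Proof. exact: lt_le_trans ltr01 p_ge1. Qed.
Let w_ge0 i : 0 <= w i. Proof. exact: ltW. Qed.

Let term_ge0 f i : 0 <= cmod (f i) * w i.
Proof. by rewrite mulr_ge0 ?cmod_ge0. Qed.

Lemma lpball_ge0 s f : lpball p w s f -> 0 <= s.
Proof. by move=> /lpball_pnormP/(_ fset0); apply: le_trans; exact: pnorm_ge0. Qed.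

Lemma lpballP s f : 0 <= s -> lpball p w s f <->
  forall A, \sum_(i <- A) (cmod (f i) * w i) `^ p <= s `^ p.
Proof.
move=> s0; apply: (iff_trans (lpball_pnormP p w s f)).
by split=> fs A; have := fs A; rewrite pnorm_le.
Qed.

Lemma lpball_le s t f : s <= t -> lpball p w s f -> lpball p w t f.
Proof.
move=> st /lpball_pnormP fs; apply/lpball_pnormP => A; exact: le_trans st.
Qed.

Lemma lpball_dom (J : choiceType) (v : J -> R) (h : J -> I) c s f (g : J -> R[i]) :
  injective h -> (forall j, 0 <= v j) -> 0 <= c ->
  (forall j, cmod (g j) * v j <= c * (cmod (f (h j)) * w (h j))) ->
  lpball p w s f -> lpball p v (c * s) g.
Proof.
move=> h_inj v0 c0 gf /lpball_pnormP fs; apply/lpball_pnormP => A.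
apply: (@le_trans _ _ (pnorm p A (fun j => c * (cmod (f (h j)) * w (h j))))).
  by apply: ler_pnorm => // j _; rewrite mulr_ge0 ?cmod_ge0//=.
rewrite pnormZ// ler_wpM2l//; have := fs [fset h j | j in A]%fset.
by rewrite /pnorm big_imfset//= => i j _ _; exact: h_inj.
Qed.

Lemma lpballZ s (c : R[i]) f : lpball p w s f -> lpball p w (cmod c * s) (c \*o f).
Proof.
apply: (@lpball_dom _ _ id) => //; first exact: cmod_ge0.
by move=> i; rewrite cmodM mulrA.
Qed.

Lemma lpballN s f : lpball p w s f -> lpball p w s (- f).
Proof.
rewrite -[X in lpball _ _ X (- _)]mul1r.
by apply: (@lpball_dom _ _ id) => // i; rewrite cmodN mul1r.
Qed.

Lemma lpballD s t f g : lpball p w s f -> lpball p w t g -> lpball p w (s + t) (f + g).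
Proof.
move=> /lpball_pnormP fs /lpball_pnormP gt; apply/lpball_pnormP => A.
apply: le_trans (lerD (fs A) (gt A)).
apply: le_trans (ler_pnormD p_gt0 A p_ge1 (term_ge0 f) (term_ge0 g)).
by apply: ler_pnorm => // i _; rewrite term_ge0 -mulrDl ler_wpM2r ?ler_cmodD.
Qed.

Lemma lpballB s t f g : lpball p w s f -> lpball p w t g -> lpball p w (s + t) (f - g).
Proof. by move=> fs /lpballN; exact: lpballD. Qed.

Lemma lpballBC s f g : lpball p w s (f - g) -> lpball p w s (g - f).
Proof. by move=> /lpballN; rewrite opprB. Qed.

Lemma lpball_coord s f i : lpball p w s f -> cmod (f i) * w i <= s.
Proof. by move=> /lpball_pnormP/(_ [fset i]%fset); rewrite pnorm_fset1. Qed.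

Lemma lpball0 : lpball p w 0 0.
Proof.
apply/lpballP => // A; rewrite big1 ?powR_ge0// => i _.
by rewrite cmod0 mul0r powR0 ?gt_eqF.
Qed.

Lemma lpball_delta i : lpball p w (w i) (delta i).
Proof.
apply/lpballP => // A; have off j : j != i -> (cmod (@delta R I i j) * w j) `^ p = 0.
  by rewrite /delta => /negbTE ->; rewrite cmod0 mul0r powR0 ?gt_eqF.
have [iA|iA] := boolP (i \in A).
  rewrite (big_fsetD1 i)//= big_seq big1 ?addr0 /delta ?eqxx ?cmod1 ?mul1r//.
  by move=> j; rewrite !inE => /andP[ji _]; exact: off.
rewrite big_seq big1 ?powR_ge0// => j jA; apply: off.
by apply: contraNneq iA => <-.
Qed.

Lemma lpball_trunc A s f : lpball p w s f -> lpball p w s (trunc A f).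
Proof.
rewrite -[X in lpball _ _ X (trunc _ _)]mul1r.
apply: (@lpball_dom _ _ id) => // i; rewrite mul1r /trunc.
by case: ifP => // _; rewrite cmod0 mul0r.
Qed.

Lemma lpw0 : lpw p w 0.
Proof. by exists 0; exact: lpball0. Qed.

Lemma lpwZD (c : R[i]) f g : lpw p w f -> lpw p w g -> lpw p w (c \*o f + g).
Proof. by move=> [s fs] [t gt]; eexists; apply: lpballD gt; exact: lpballZ fs. Qed.

Lemma lpwD f g : lpw p w f -> lpw p w g -> lpw p w (f + g).
Proof. by move=> [s fs] [t gt]; eexists; apply: lpballD fs gt. Qed.

Lemma lpwB f g : lpw p w f -> lpw p w g -> lpw p w (f - g).
Proof. by move=> [s fs] [t gt]; eexists; apply: lpballB fs gt. Qed.

Lemma lpw_finsupp f : finsupp f -> lpw p w f.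
Proof.
move: f; apply: finsupp_ind => [|c i f _]; first exact: lpw0.
by apply: lpwZD; exists (w i); exact: lpball_delta.
Qed.

End WeightedLp.

Section NormConvergence.
Variables (R : realType) (I : choiceType) (p : R) (w : I -> R).
Hypotheses (p_ge1 : 1 <= p) (w_gt0 : forall i, 0 < w i).
Variables (T : Type) (F : set_system T).
Context {FF : ProperFilter F}.
Implicit Types (f g : I -> R[i]) (u v : T -> I -> R[i]) (s e : R).

Let p_gt0 : 0 < p. Proof. exact: lt_le_trans ltr01 p_ge1. Qed.

Let term_ge0 f i : 0 <= cmod (f i) * w i.
Proof. by rewrite mulr_ge0 ?cmod_ge0 ?ltW. Qed.

Lemma lpcvg_coord u f i : lpcvg p w F u f -> ccvg F (u ^~ i) (f i).
Proof.
move=> uf; apply/ccvgP => e e0.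
apply: filterS (uf _ (mulr_gt0 e0 (w_gt0 i))) => x /(lpball_coord p_ge1 w_gt0 i).
by rewrite ler_pM2r.
Qed.

Lemma lpcvg_unique u f g : lpcvg p w F u f -> lpcvg p w F u g -> f = g.
Proof.
move=> /lpcvg_coord uf /lpcvg_coord ug; apply/funext => i.
exact: ccvg_unique (uf i) (ug i).
Qed.

Lemma lpcvgD u v f g : lpcvg p w F u f -> lpcvg p w F v g ->
  lpcvg p w F (fun x => u x + v x) (f + g).
Proof.
move=> uf vg e e0; have e20 : 0 < e / 2 by rewrite divr_gt0.
apply: filterS2 (uf _ e20) (vg _ e20) => x ufx vgx.
by rewrite opprD addrACA [e]splitr; exact: lpballD ufx vgx.
Qed.

Lemma lpcvgZ (c : R[i]) u f : lpcvg p w F u f ->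
  lpcvg p w F (fun x => c \*o u x) (c \*o f).
Proof.
move=> uf e e0; have c0 : 0 < cmod c + 1 by rewrite ltr_wpDl ?cmod_ge0.
apply: filterS (uf _ (divr_gt0 e0 c0)) => x /(lpballZ p_ge1 w_gt0 c).
rewrite (_ : c \*o _ = c \*o u x - c \*o f); last first.
  by apply/funext => i; rewrite !fctE /= mulrBr.
by apply: lpball_le; rewrite ler_mul_divD1 ?cmod_ge0 ?(ltW e0).
Qed.

Lemma lpcvg_cst f : lpcvg p w F (fun=> f) f.
Proof.
move=> e e0; apply: filterE => x; rewrite subrr.
by apply: lpball_le (ltW e0) _; exact: lpball0.
Qed.

Lemma lpball_ccvg s u f : (forall i, ccvg F (u ^~ i) (f i)) ->
  (\forall x \near F, lpball p w s (u x)) -> lpball p w s f.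
Proof.
move=> uf us; apply/lpball_pnormP => A; apply/ler_addgt0Pr => e e0.
pose d := e / (#|` A|%:R `^ p^-1 + 1).
have D0 : 0 < #|` A|%:R `^ p^-1 + 1 :> R by rewrite ltr_wpDl ?powR_ge0.
have d0 : 0 < d by rewrite divr_gt0.
have : F (\bigcap_(i in [set` A]) [set x | cmod (u x i - f i) <= d / w i]).
  apply: filter_bigI => i _; have /ccvgP := uf i; apply.
  by rewrite divr_gt0.
move=> /(filterI us) /filter_ex[x [/lpball_pnormP usx ufx]].
apply: (@le_trans _ _ (pnorm p A (fun i => cmod (u x i) * w i) +
                       pnorm p A (fun i => cmod (f i - u x i) * w i))).
  apply: le_trans (ler_pnormD p_gt0 A p_ge1 (term_ge0 (u x)) (term_ge0 (f - u x))).
  apply: ler_pnorm => // i _; rewrite term_ge0 -mulrDl ler_wpM2r ?(ltW (w_gt0 i))//.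
  by rewrite -[X in cmod X <= _](subrK (u x i)) addrC ler_cmodD.
apply: lerD (usx A) _; apply: (@le_trans _ _ (pnorm p A (fun=> d))).
  apply: ler_pnorm => // i iA; rewrite (term_ge0 (f - u x)) -ler_pdivlMr// cmod_distC.
  exact: ufx.
by rewrite pnorm_cst ?(ltW d0)// ler_mul_divD1 ?powR_ge0 ?(ltW e0).
Qed.

Lemma lpball_cvg s u f : lpcvg p w F u f ->
  (\forall x \near F, lpball p w s (u x)) -> lpball p w s f.
Proof. by move=> uf; apply: lpball_ccvg => i; exact: lpcvg_coord. Qed.

Lemma lpcvg_lpw u f : lpcvg p w F u f -> (\forall x \near F, lpw p w (u x)) ->
  lpw p w f.
Proof.
move=> /(_ 1 ltr01) uf /(filterI uf) /filter_ex[x [ufx ux]].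
rewrite -[f](subKr (u x)).
exact: (lpwB p_ge1 w_gt0 ux (ex_intro _ 1 ufx)).
Qed.

Lemma lpcvg_cauchy u :
  (forall e, 0 < e -> exists g, \forall x \near F, lpball p w e (u x - g)) ->
  exists f, lpcvg p w F u f.
Proof.
move=> cauchy_u.
have /choice[f uf] i : exists l, ccvg F (u ^~ i) l.
  apply: ccvg_cauchy => e e0; have [g ug] := cauchy_u _ (mulr_gt0 e0 (w_gt0 i)).
  exists (g i); apply: filterS ug => x /(lpball_coord p_ge1 w_gt0 i).
  by rewrite ler_pM2r.
exists f => e e0; have [g ug] := cauchy_u (e / 2) (divr_gt0 e0 (ltr0Sn _ 1)).
have fg : lpball p w (e / 2) (f - g).
  apply: (@lpball_ccvg _ (fun x => u x - g)) ug => i.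
  exact: ccvgD (uf i) (ccvg_cst (- g i)).
apply: filterS ug => x ug.
by have := lpballD p_ge1 w_gt0 ug (lpballBC p_ge1 w_gt0 fg); rewrite addrA subrK -splitr.
Qed.

End NormConvergence.
Arguments lpcvg_cst {R I p} w p_ge1 {T} F {FF} f.

Section Truncation.
Variables (R : realType) (I : choiceType) (p : R) (w : I -> R).
Hypotheses (p_ge1 : 1 <= p) (w_gt0 : forall i, 0 < w i).
Implicit Types (f g : I -> R[i]) (e : R).
#[local] Existing Instance totally_filter.

Let p_gt0 : 0 < p. Proof. exact: lt_le_trans ltr01 p_ge1. Qed.

Lemma lpcvg_trunc f : lpw p w f -> lpcvg p w totally (trunc ^~ f) f.
Proof.
move=> [s fs] e e0; have s0 := lpball_ge0 fs.
have [A tailA] := sum_nneg_tail (fun i => powR_ge0 _ p)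
  ((lpballP w p_ge1 f s0).1 fs) (powR_gt0 p e0).
apply: (@near_totally _ _ A) => D AD; apply/lpballP => // [|B]; first exact: ltW.
rewrite (big_fsetID _ (mem D)) /= big_seq big1 ?add0r => [|i].
  apply: le_trans (tailA [fset i in B | i \notin D]%fset _); last first.
    apply/fdisjointP => i /(fsubsetP AD) iD.
    by rewrite !inE /= iD andbF.
  rewrite big_seq [leRHS]big_seq; apply: ler_sum => i; rewrite !inE /= => /andP[_ iD].
  by rewrite !fctE trunc_notin// sub0r cmodN.
rewrite !inE /= => /andP[_ iD].
by rewrite !fctE truncE// subrr cmod0 mul0r powR0// gt_eqF.
Qed.

Lemma finsupp_dense f e : lpw p w f -> 0 < e ->
  exists2 g, finsupp g & lpball p w e (f - g).
Proof.
move=> /lpcvg_trunc fA /fA /filter_ex[A]; exists (trunc A f); first exact: finsupp_trunc.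
exact: lpballBC.
Qed.

Lemma lpcvg_geometric c r (u : nat -> I -> R[i]) : 0 <= r < 1 ->
  (forall k, lpball p w (c * r ^+ k) (u k.+1 - u k)) ->
  exists2 f, lpcvg p w \oo u f &
    forall k, lpball p w (c / (1 - r) * r ^+ k) (f - u k).
Proof.
move=> /andP[r0 r1] u_step.
have r_lt1 : 0 < 1 - r by rewrite subr_gt0.
have c0 : 0 <= c by have := lpball_ge0 (u_step 0%N); rewrite expr0 mulr1.
have u_diff k m : lpball p w (c / (1 - r) * (r ^+ k - r ^+ (k + m))) (u (k + m)%N - u k).
  elim: m => [|m IHm]; first by rewrite addn0 !subrr mulr0; exact: lpball0.
  have := lpballD p_ge1 w_gt0 (u_step (k + m)%N) IHm; rewrite addrA subrK addnS.
  apply: lpball_le; rewrite exprSr le_eqVlt; apply/orP; left; apply/eqP.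
  by field; rewrite gt_eqF.
have u_tail k m : (k <= m)%N -> lpball p w (c / (1 - r) * r ^+ k) (u m - u k).
  move=> km; rewrite -(subnKC km); apply: lpball_le (u_diff _ _).
  by rewrite ler_wpM2l ?divr_ge0 ?(ltW r_lt1)// gerBl exprn_ge0.
have [e e0|f uf] := @lpcvg_cauchy _ _ _ _ p_ge1 w_gt0 _ \oo _ u.
  have r_norm : `|r| < 1 by rewrite ger0_norm.
  have /cvgrPdist_le := cvg_geometric (c / (1 - r)) r_norm.
  move=> /(_ _ e0)[k _ rk].
  exists (u k); exists k => // m /= km; apply: lpball_le (u_tail _ _ km).
  have := rk k (leqnn k); rewrite sub0r normrN; apply: le_trans.
  exact: ler_norm.
exists f => // k.
apply: (@lpball_cvg _ _ _ _ p_ge1 w_gt0 _ \oo _ _ (fun m => u m - u k)).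
  exact: lpcvgD uf (lpcvg_cst w p_ge1 \oo (- u k)).
by exists k => // m; exact: u_tail.
Qed.

End Truncation.

(** * Bounded linear operators *)

Definition lin_on {R : realType} {I J : Type} (P : (I -> R[i]) -> Prop)
    (T : (I -> R[i]) -> J -> R[i]) : Prop :=
  forall (c : R[i]) f g, P f -> P g -> T (c \*o f + g) = c \*o T f + T g.

Definition bounded_on {R : realType} {I J : choiceType} (P : (I -> R[i]) -> Prop)
    (p : R) (w : I -> R) (v : J -> R) (T : (I -> R[i]) -> J -> R[i]) : Prop :=
  exists2 C : R, 0 <= C &
    forall f s, P f -> lpball p w s f -> lpball p v (C * s) (T f).

Section LinearOn.
Variables (R : realType) (I J : Type) (P : (I -> R[i]) -> Prop).
Variable T : (I -> R[i]) -> J -> R[i].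
Hypothesis T_lin : lin_on P T.

Lemma lin_onD f g : P f -> P g -> T (f + g) = T f + T g.
Proof.
by move=> Pf Pg; have := T_lin 1 Pf Pg; rewrite !mul1_fun.
Qed.

Lemma lin_onB f g : P f -> P g -> T (f - g) = T f - T g.
Proof.
by move=> Pf Pg; rewrite addrC -mulN1_fun T_lin// mulN1_fun addrC.
Qed.

Lemma lin_on0 : P 0 -> T 0 = 0.
Proof. by move=> P0; rewrite -[X in T X](subrr (0 : I -> R[i])) lin_onB// subrr. Qed.

Lemma lin_onZ (c : R[i]) f : P 0 -> P f -> T (c \*o f) = c \*o T f.
Proof. by move=> P0 Pf; have := T_lin c Pf P0; rewrite (lin_on0 P0) !addr0. Qed.

End LinearOn.

Section LinearOnComposition.
Variables (R : realType) (I J L : Type).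
Variables (P : (I -> R[i]) -> Prop) (Q : (J -> R[i]) -> Prop).

Lemma lin_on_sub (P' : (I -> R[i]) -> Prop) (T : (I -> R[i]) -> J -> R[i]) :
  (forall f, P' f -> P f) -> lin_on P T -> lin_on P' T.
Proof. by move=> P'P T_lin c f g /P'P Pf /P'P; exact: T_lin. Qed.

Lemma lin_on_comp (S : (J -> R[i]) -> L -> R[i]) (T : (I -> R[i]) -> J -> R[i]) :
  (forall f, P f -> Q (T f)) -> lin_on Q S -> lin_on P T -> lin_on P (S \o T).
Proof. by move=> PQ S_lin T_lin c f g Pf Pg /=; rewrite T_lin// S_lin//; exact: PQ. Qed.

End LinearOnComposition.

Section BoundedOperators.
Variables (R : realType) (I J : choiceType) (p : R) (w : I -> R) (v : J -> R).
Hypotheses (p_ge1 : 1 <= p) (w_gt0 : forall i, 0 < w i) (v_gt0 : forall j, 0 < v j).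
Implicit Types (f : I -> R[i]) (S T : (I -> R[i]) -> J -> R[i]).
#[local] Existing Instance totally_filter.

Lemma bounded_on_lpw T f : bounded_on (lpw p w) p w v T -> lpw p w f -> lpw p v (T f).
Proof. by move=> [C _ TC] [s fs]; exists (C * s); exact: TC (ex_intro _ s fs) fs. Qed.

Lemma lpcvg_bounded_lin (X : Type) (F : set_system X) (u : X -> I -> R[i]) f T :
  Filter F -> lin_on (lpw p w) T -> bounded_on (lpw p w) p w v T ->
  (forall x, lpw p w (u x)) -> lpw p w f -> lpcvg p w F u f ->
  lpcvg p v F (fun x => T (u x)) (T f).
Proof.
move=> FF T_lin [C C0 TC] mu mf uf e e0.
have C1 : 0 < C + 1 by rewrite ltr_wpDl.
apply: filterS (uf _ (divr_gt0 e0 C1)) => x ufx; rewrite -(lin_onB T_lin)//.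
apply: lpball_le (TC _ _ (lpwB p_ge1 w_gt0 (mu x) mf) ufx).
by rewrite ler_mul_divD1 ?(ltW e0).
Qed.

Lemma eq_bounded_lin S T : lin_on (lpw p w) S -> bounded_on (lpw p w) p w v S ->
  lin_on (lpw p w) T -> bounded_on (lpw p w) p w v T ->
  (forall f, finsupp f -> S f = T f) -> forall f, lpw p w f -> S f = T f.
Proof.
move=> S_lin S_bdd T_lin T_bdd ST f mf.
have mfA A : lpw p w (trunc A f) := lpw_finsupp p_ge1 w_gt0 (finsupp_trunc A f).
have fA := lpcvg_trunc p_ge1 mf.
apply: (lpcvg_unique p_ge1 v_gt0 (lpcvg_bounded_lin _ S_lin S_bdd mfA mf fA)).
rewrite (_ : (fun A => S _) = fun A => T (trunc A f)).
  exact: lpcvg_bounded_lin.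
by apply/funext => A; exact/ST/finsupp_trunc.
Qed.

Lemma lpcvg_trunc_bounded_lin T f : lin_on finsupp T -> bounded_on finsupp p w v T ->
  lpw p w f -> exists g, lpcvg p v totally (fun A => T (trunc A f)) g.
Proof.
move=> T_lin [C C0 TC] mf.
have fin_trunc A : finsupp (trunc A f) := finsupp_trunc A f.
apply: (lpcvg_cauchy p_ge1 v_gt0) => e e0.
have C1 : 0 < C + 1 by rewrite ltr_wpDl.
have fA := lpcvg_trunc p_ge1 mf (divr_gt0 (divr_gt0 e0 (ltr0Sn _ 1)) C1).
have [A fAe] := filter_ex fA; exists (T (trunc A f)).
apply: filterS fA => B fBe.
have := lpballD p_ge1 w_gt0 fBe (lpballBC p_ge1 w_gt0 fAe).
rewrite addrA subrK -mulrDl -splitr => fBA.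
rewrite -(lin_onB T_lin)//; apply: lpball_le (TC _ _ _ fBA); last exact: finsuppB.
by rewrite ler_mul_divD1 ?(ltW e0).
Qed.

Lemma bounded_lin_extension T : lin_on finsupp T -> bounded_on finsupp p w v T ->
  exists S, [/\ forall f, finsupp f -> S f = T f, lin_on (lpw p w) S &
    bounded_on (lpw p w) p w v S].
Proof.
move=> T_lin T_bdd; have [C C0 TC] := T_bdd.
have fin_trunc A f : finsupp (trunc A f) := finsupp_trunc A f.
have /choice[S TS] f : exists g : J -> R[i], lpw p w f ->
    lpcvg p v totally (fun A => T (trunc A f)) g.
  have [mf|nf] := pselect (lpw p w f); last by exists 0 => /nf.
  by have [g Tg] := lpcvg_trunc_bounded_lin T_lin T_bdd mf; exists g.
exists S; split=> [f fin_f|c f g mf mg|].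
- have mf := lpw_finsupp p_ge1 w_gt0 fin_f.
  apply: (lpcvg_unique p_ge1 v_gt0 (TS f mf)) => e e0.
  have [A fA] := fin_f; apply: (@near_totally _ _ A) => B AB.
  have -> : trunc B f = f.
    apply/funext => i; have [iB|iB] := boolP (i \in B); first exact: truncE.
    rewrite trunc_notin// fA trunc_notin//.
    by apply: contraNN iB; exact: (fsubsetP AB).
  by rewrite subrr; apply: lpball_le (ltW e0) _; exact: lpball0.
- have mcfg := lpwZD p_ge1 w_gt0 c mf mg.
  apply: (lpcvg_unique p_ge1 v_gt0 (TS _ mcfg)).
  rewrite (_ : (fun A => _) = fun A => c \*o T (trunc A f) + T (trunc A g)).
    exact: (lpcvgD p_ge1 v_gt0 (lpcvgZ p_ge1 v_gt0 c (TS f mf)) (TS g mg)).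
  apply/funext => A; rewrite -T_lin//; congr T; apply/funext => i.
  by rewrite /trunc !fctE /=; case: ifP => // _; rewrite mulr0 addr0.
- exists C => // f s mf fs; apply: (lpball_cvg p_ge1 v_gt0 (TS f mf)).
  apply: (@near_totally _ _ fset0) => A _; apply: TC => //.
  exact: lpball_trunc.
Qed.

End BoundedOperators.

Section BoundedOnComposition.
Variables (R : realType) (I J L : choiceType) (p : R).
Variables (P : (I -> R[i]) -> Prop) (Q : (J -> R[i]) -> Prop).
Variables (w : I -> R) (v : J -> R).

Lemma bounded_on_sub (P' : (I -> R[i]) -> Prop) (w' : I -> R) (v' : J -> R)
    (T : (I -> R[i]) -> J -> R[i]) : (forall f, P' f -> P f) ->
  (forall s f, lpball p w' s f -> lpball p w s f) ->
  (forall s g, lpball p v s g -> lpball p v' s g) ->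
  bounded_on P p w v T -> bounded_on P' p w' v' T.
Proof.
move=> P'P ww' vv' [C C0 TC]; exists C => // f s /P'P Pf /ww' fs.
exact/vv'/TC.
Qed.

Lemma bounded_on_comp (u : L -> R) (S : (J -> R[i]) -> L -> R[i])
    (T : (I -> R[i]) -> J -> R[i]) : (forall f, P f -> Q (T f)) ->
  bounded_on Q p v u S -> bounded_on P p w v T -> bounded_on P p w u (S \o T).
Proof.
move=> PQ [C C0 SC] [D D0 TD]; exists (C * D) => [|f s Pf fs]; first exact: mulr_ge0.
by rewrite -mulrA; apply: SC; [exact: PQ|exact: TD].
Qed.

End BoundedOnComposition.

Lemma neumann (R : realType) (I : choiceType) (p : R) (w : I -> R) (q : R)
    (L : (I -> R[i]) -> I -> R[i]) (r : I -> R[i]) :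
  1 <= p -> (forall i, 0 < w i) -> 0 <= q < 1 -> lin_on (lpw p w) L ->
  (forall f s, lpball p w s f -> lpball p w (q * s) (L f)) -> lpw p w r ->
  exists2 x, lpw p w x & x = r + L x.
Proof.
move=> p_ge1 w_gt0 q01 L_lin Lq mr; have /andP[q0 q1] := q01.
have L_lpw f : lpw p w f -> lpw p w (L f) by move=> [s /Lq]; exists (q * s).
pose u k : I -> R[i] := iter k (fun x => r + L x) 0.
have mu k : lpw p w (u k).
  by elim: k => [|k IHk]; [exact: lpw0|exact: lpwD mr (L_lpw _ IHk)].
have [t rt] := mr.
have [k|x ux _] := @lpcvg_geometric _ _ _ _ p_ge1 w_gt0 t _ u q01.
  elim: k => [|k IHk].
    by rewrite expr0 mulr1 /= subr0 (lin_on0 L_lin) ?addr0//; exact: lpw0.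
  have -> : u k.+2 - u k.+1 = L (u k.+1 - u k).
    have -> : u k.+2 - u k.+1 = r + L (u k.+1) - (r + L (u k)) by [].
    by rewrite (lin_onB L_lin)// opprD addrACA subrr add0r.
  by rewrite exprS mulrCA; exact: Lq.
have mx : lpw p w x by apply: (lpcvg_lpw p_ge1 w_gt0 ux); exact: filterE.
exists x => //.
have uSx : lpcvg p w \oo (fun k => u k.+1) x.
  by move=> e /ux[N _ uN]; exists N => // k Nk; exact: uN (leqW Nk).
apply: (lpcvg_unique p_ge1 w_gt0 uSx).
apply: (lpcvgD p_ge1 w_gt0 (lpcvg_cst w p_ge1 \oo r)).
apply: (lpcvg_bounded_lin p_ge1 w_gt0 _ L_lin _ mu mx ux).
by exists q => // f s _; exact: Lq.
Qed.

(** * Uniform boundedness *)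

Definition seminorm_on {R : realType} {I : Type} (P : (I -> R[i]) -> Prop)
    (q : (I -> R[i]) -> R) : Prop :=
  (forall f g, P f -> P g -> q (f + g) <= q f + q g) /\
  (forall (c : R[i]) f, P f -> q (c \*o f) = cmod c * q f).

Section Seminorms.
Variables (R : realType) (I : choiceType) (p : R) (w : I -> R).
Hypotheses (p_ge1 : 1 <= p) (w_gt0 : forall i, 0 < w i).
Implicit Types (f g d : I -> R[i]) (q : (I -> R[i]) -> R) (s : R).

Section OneSeminorm.
Variable q : (I -> R[i]) -> R.
Hypothesis q_seminorm : seminorm_on (lpw p w) q.

Lemma seminorm_onN f : lpw p w f -> q (- f) = q f.
Proof. by move=> mf; rewrite -mulN1_fun q_seminorm.2// cmodN cmod1 mul1r. Qed.

Lemma seminorm_on_sub f g : lpw p w f -> lpw p w g -> q f - q g <= q (f - g).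
Proof.
move=> mf mg; rewrite lerBlDr -{1}(subrK g f).
exact: q_seminorm.1 (lpwB p_ge1 w_gt0 mf mg) mg.
Qed.

(* [2 d = (f + d) - (f - d)]. *)
Lemma seminorm_on_translate f d : lpw p w f -> lpw p w d ->
  q (f + d) < q d -> q d <= q (f - d).
Proof.
move=> mf md fd_lt.
have : q (d + d) <= q (f + d) + q (f - d).
  rewrite -(seminorm_onN (lpwB p_ge1 w_gt0 mf md)).
  rewrite (_ : d + d = f + d + - (f - d)); last first.
    by rewrite opprB [f + d]addrC -addrA [f + _]addrC subrK.
  apply: q_seminorm.1; first exact: lpwD.
  by rewrite opprB; exact: lpwB.
rewrite (_ : d + d = 2 \*o d) ?q_seminorm.2//; last first.
  by apply/funext => i; rewrite fctE /= mulr_natl mulr2n.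
by rewrite (_ : cmod 2 = 2) ?(cmod_int R 2)//; lra.
Qed.

(* [M] is the supremum of [q] over the unit ball. *)
Lemma seminorm_best_bound :
  (exists K, forall f s, lpball p w s f -> q f <= K * s) ->
  exists2 M, forall f s, lpball p w s f -> q f <= M * s &
    exists2 y, lpball p w 1 y & M / 2 <= q y.
Proof.
move=> [K qK]; pose S := [set q y | y in lpball p w 1].
have q0 : q 0 = 0.
  have := q_seminorm.2 0 0 (lpw0 w p_ge1); rewrite cmod0 mul0r => <-; congr q.
  by apply/funext => i /=; rewrite mul0r.
have S0 : S 0 by exists 0 => //; apply: lpball_le ler01 _; exact: lpball0.
have supS : has_sup S.
  by split; [exists 0|exists (K * 1) => _ [y y1 <-]; exact: qK].
have sup0 : 0 <= sup S by exact: sup_upper_bound.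
exists (sup S) => [f s fs|]; last first.
  have [->|S_neq0] := eqVneq (sup S) 0.
    by exists 0; rewrite ?mul0r ?q0//; apply: lpball_le ler01 _; exact: lpball0.
  have half_gt0 : 0 < sup S / 2 by rewrite divr_gt0// lt0r S_neq0.
  have [_ [y y1 <-] /ltW qy] := sup_adherent half_gt0 supS.
  by exists y => //; move: qy; rewrite {1}[sup S]splitr addrK.
have s0 := lpball_ge0 fs.
have [s_eq0|s_neq0] := eqVneq s 0.
  by move: fs; rewrite s_eq0 => /qK; rewrite !mulr0.
have s_gt0 : 0 < s by rewrite lt0r s_neq0.
have cV : cmod (s^-1)%:C%C = s^-1 by rewrite cmod_real ger0_norm ?invr_ge0.
have : q ((s^-1)%:C%C \*o f) <= sup S.
  apply: sup_upper_bound => //; exists ((s^-1)%:C%C \*o f) => //.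
  by have := lpballZ p_ge1 w_gt0 (s^-1)%:C%C fs; rewrite cV mulVf.
by rewrite q_seminorm.2 ?cV; [rewrite mulrC ler_pdivrMr|exists s].
Qed.

End OneSeminorm.

(* Sokal's gliding hump: [u k] is moved by [+- 4 ^- k y k], with the sign making the
   [k]-th seminorm large; the later moves are too small to undo this. *)
Lemma gliding_hump (q : nat -> (I -> R[i]) -> R) (M : nat -> R) (y : nat -> I -> R[i]) :
  (forall k, seminorm_on (lpw p w) (q k)) ->
  (forall k f s, lpball p w s f -> q k f <= M k * s) ->
  (forall k, lpball p w 1 (y k)) -> (forall k, M k / 2 <= q k (y k)) ->
  exists2 f, lpw p w f & forall k, M k / (6 * 4 ^+ k) <= q k f.
Proof.
move=> q_seminorm qM y1 qy.
pose d k : I -> R[i] := ((4^-1 ^+ k)%:C%C) \*o y k.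
have d_ball k : lpball p w (1 * 4^-1 ^+ k) (d k).
  have := lpballZ p_ge1 w_gt0 ((4^-1 ^+ k)%:C%C) (y1 k).
  by rewrite cmod_real ger0_norm ?exprn_ge0// mulrC.
have md k : lpw p w (d k) by exists (1 * 4^-1 ^+ k).
have qd k : M k / 2 * 4^-1 ^+ k <= q k (d k).
  rewrite (q_seminorm k).2; last by exists 1.
  by rewrite cmod_real ger0_norm ?exprn_ge0// mulrC ler_wpM2l ?exprn_ge0.
pose u := fix u k : I -> R[i] :=
  if k is j.+1 then if q j (d j) <= q j (u j + d j) then u j + d j else u j - d j
  else 0.
have u_step k : u k.+1 = u k + d k \/ u k.+1 = u k - d k.
  by rewrite /=; case: ifP => _; [left|right].
have mu k : lpw p w (u k).
  elim: k => [|k IHk]; first exact: lpw0.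
  by case: (u_step k) => ->; [exact: lpwD|exact: lpwB].
have qu k : q k (d k) <= q k (u k.+1).
  rewrite /=; case: ifPn => //; rewrite -ltNge.
  exact: seminorm_on_translate.
have r01 : 0 <= (4^-1 : R) < 1 by rewrite invr_ge0 ler0n invf_lt1// ltr1n.
have [k|f uf f_ball] := lpcvg_geometric p_ge1 w_gt0 (c := 1) (u := u) r01.
  case: (u_step k) => ->; rewrite addrC addKr; first exact: d_ball.
  exact: lpballN.
have mf : lpw p w f by apply: (lpcvg_lpw p_ge1 w_gt0 uf); exact: filterE.
exists f => // k.
have := qM k _ _ (lpballBC p_ge1 w_gt0 (f_ball k.+1)).
have := seminorm_on_sub (q_seminorm k) (mu k.+1) mf.
have := le_trans (qd k) (qu k).
rewrite exprS (_ : M k / (6 * 4 ^+ k) = M k * 4^-1 ^+ k / 6); last first.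
  by rewrite invfM exprVn; ring.
rewrite (_ : 1 / (1 - 4^-1) * (4^-1 * 4^-1 ^+ k) = 4^-1 ^+ k / 3); last by field.
by move: (4^-1 ^+ k) => x; lra.
Qed.

Theorem uniform_boundedness (J : Type) (q : J -> (I -> R[i]) -> R) :
  (forall j, seminorm_on (lpw p w) (q j)) ->
  (forall j, exists K, forall f s, lpball p w s f -> q j f <= K * s) ->
  (forall f, lpw p w f -> exists B, forall j, q j f <= B) ->
  exists2 C, 0 <= C & forall j f s, lpball p w s f -> q j f <= C * s.
Proof.
move=> q_seminorm q_bdd q_ptw; apply: contrapT => unbounded.
have /choice[x xP] (k : nat) : exists x : J * R * (I -> R[i]),
    [/\ forall f s, lpball p w s f -> q x.1.1 f <= x.1.2 * s, lpball p w 1 x.2,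
       x.1.2 / 2 <= q x.1.1 x.2 & k%:R * (6 * 4 ^+ k) <= x.1.2].
  have C0 : 0 <= k%:R * (6 * 4 ^+ k) :> R by rewrite !mulr_ge0// exprn_ge0.
  have [[j [f [s [fs qf]]]]|bounded] := pselect (exists j f s,
      lpball p w s f /\ k%:R * (6 * 4 ^+ k) * s < q j f).
    have [M qM [y y1 qy]] := seminorm_best_bound (q_seminorm j) (q_bdd j).
    exists (j, M, y); split=> //=; rewrite leNgt; apply/negP => /ltW M_le.
    have := lt_le_trans qf (qM _ _ fs); rewrite ltNge ler_wpM2r//.
    exact: lpball_ge0 fs.
  exfalso; apply: unbounded; exists (k%:R * (6 * 4 ^+ k)) => // j f s fs.
  by rewrite leNgt; apply/negP => qf; apply: bounded; exists j, f, s.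
have [f mf qf] := @gliding_hump (fun k => q (x k).1.1) (fun k => (x k).1.2)
  (fun k => (x k).2) (fun k => q_seminorm _) (fun k => let: And4 h _ _ _ := xP k in h)
  (fun k => let: And4 _ h _ _ := xP k in h) (fun k => let: And4 _ _ h _ := xP k in h).
have [B qB] := q_ptw f mf.
have B0 : 0 <= B.
  apply: le_trans (qB (x 0%N).1.1); apply: le_trans (qf 0%N).
  have [_ _ _] := xP 0%N; rewrite mul0r => M0.
  by rewrite divr_ge0// mulr_ge0// exprn_ge0.
pose k := Num.bound B.
suff : k%:R <= B by rewrite leNgt archi_boundP.
apply: le_trans (qB (x k).1.1); apply: le_trans (qf k).
have [_ _ _] := xP k; rewrite ler_pdivlMr// mulr_gt0// exprn_gt0.
Qed.

Lemma bounded_on_coord (J : choiceType) (v : J -> R) (T : (I -> R[i]) -> J -> R[i]) :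
  (forall j, 0 < v j) -> lin_on (lpw p w) T ->
  (forall f, lpw p w f -> lpw p v (T f)) ->
  (forall j, exists K, forall f s, lpball p w s f -> cmod (T f j) <= K * s) ->
  bounded_on (lpw p w) p w v T.
Proof.
move=> v_gt0 T_lin T_lpw /choice[K TK].
have p_gt0 : 0 < p by exact: lt_le_trans ltr01 p_ge1.
have term_ge0 f j : 0 <= cmod (T f j) * v j by rewrite mulr_ge0 ?cmod_ge0 ?ltW.
pose q (A : {fset J}) f := pnorm p A (fun j => cmod (T f j) * v j).
have [A|A|f mf|C C0 qC] := @uniform_boundedness {fset J} q; last first.
- by exists C => // f s _ fs; apply/lpball_pnormP => A; exact: qC.
- by have [B /lpball_pnormP fB] := T_lpw f mf; exists B.
- exists (pnorm p A (fun j => `|K j| * v j)) => f s fs; have s0 := lpball_ge0 fs.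
  rewrite [leRHS]mulrC -(pnormZ p_gt0 A s0) => [|j]; last first.
    exact: mulr_ge0 (normr_ge0 _) (ltW (v_gt0 j)).
  apply: ler_pnorm => // j _; rewrite term_ge0 mulrA ler_pM2r//.
  by rewrite mulrC (le_trans (TK j f s fs))// ler_wpM2r// ler_norm.
- split=> [f g mf mg|c f mf]; rewrite /q.
    apply: le_trans (ler_pnormD p_gt0 A p_ge1 (term_ge0 f) (term_ge0 g)).
    apply: ler_pnorm => // j _; rewrite term_ge0 -mulrDl ler_pM2r//.
    by rewrite (lin_onD T_lin)// ler_cmodD.
  rewrite (lin_onZ T_lin c (lpw0 w p_ge1) mf).
  rewrite -(pnormZ p_gt0 A (cmod_ge0 c) (term_ge0 f)).
  by congr pnorm; apply/funext => j /=; rewrite cmodM mulrA.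
Qed.

End Seminorms.

(** * Convolution *)

Notation l1ball := (lpball 1 (fun=> 1)).
Notation l1 := (lpw 1 (fun=> 1)).

Section SummableSequences.
Variables (R : realType).
Implicit Types (f : int -> R[i]) (s : R).

Let one_gt0 (n : int) : 0 < (1 : R). Proof. exact: ltr01. Qed.

Lemma l1ballP s f : l1ball s f <->
  forall A : {fset int}, \sum_(n <- A) cmod (f n) <= s.
Proof.
have pnorm_cmod A : pnorm 1 A (fun n => cmod (f n) * 1) = \sum_(n <- A) cmod (f n).
  rewrite pnorm1E => [|n]; last by rewrite mulr1 cmod_ge0.
  by under eq_bigr do rewrite mulr1.
apply: (iff_trans (lpball_pnormP _ _ _ _)); split=> fs A; first by rewrite -pnorm_cmod.
by rewrite pnorm_cmod.
Qed.

Lemma lpball_cmod_le (p : R) (w : int -> R) s f n : 1 <= p ->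
  (forall n, 1 <= w n) -> lpball p w s f -> cmod (f n) <= s.
Proof.
move=> p1 w1 fs; have w_gt0 m : 0 < w m by exact: lt_le_trans ltr01 (w1 m).
by apply: le_trans (lpball_coord p1 w_gt0 n fs); rewrite ler_peMr ?cmod_ge0.
Qed.

Lemma has_sum_zsum_l1 f : l1 f -> has_sum f (zsum f).
Proof.
by move=> [s /l1ballP /has_sum_exists[l fl]]; rewrite (has_sum_zsum fl).
Qed.

Lemma cmod_zsum_le s f : l1ball s f -> cmod (zsum f) <= s.
Proof.
move=> fs; have /has_sum_zsum_l1 fl : l1 f by exists s.
by apply: (has_sum_cmod_le fl); exact/l1ballP.
Qed.

End SummableSequences.

Section Convolution.
Variable R : realType.
Implicit Types (f g : int -> R[i]) (s t : R).

Let one_gt0 (n : int) : 0 < (1 : R). Proof. exact: ltr01. Qed.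

Lemma l1_conv_term f g t (n : int) : l1 f -> (forall m, cmod (g m) <= t) ->
  l1 (fun k => f k * g (n - k)).
Proof.
move=> [s fs] gt; exists (t * s).
have t0 : 0 <= t by exact: le_trans (cmod_ge0 _) (gt 0).
apply: (lpball_dom (lexx 1) one_gt0 (h := id) _ _ t0 _ fs) => // k.
by rewrite !mulr1 cmodM mulrC ler_wpM2r ?cmod_ge0.
Qed.

Lemma has_sum_conv f g t : l1 f -> (forall m, cmod (g m) <= t) ->
  forall n : int, has_sum (fun k => f k * g (n - k)) (conv f g n).
Proof. by move=> mf gt n; exact: has_sum_zsum_l1 (l1_conv_term n mf gt). Qed.

Lemma has_sum_convC f g t : l1 f -> (forall m, cmod (g m) <= t) ->
  forall n : int, has_sum (fun k => g k * f (n - k)) (conv f g n).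
Proof.
move=> mf gt n; have subK : cancel (fun k : int => n - k) (fun k => n - k).
  by move=> k; rewrite subKr.
have := has_sum_reindex subK subK (has_sum_conv mf gt n).
by congr has_sum; apply/funext => k /=; rewrite subKr mulrC.
Qed.

Lemma convC f g t : l1 f -> (forall m, cmod (g m) <= t) -> conv g f = conv f g.
Proof.
by move=> mf gt; apply/funext => n; apply: has_sum_zsum; exact: has_sum_convC.
Qed.

Lemma conv_linl (c : R[i]) f f' g t : l1 f -> l1 f' -> (forall m, cmod (g m) <= t) ->
  conv (c \*o f + f') g = c \*o conv f g + conv f' g.
Proof.
move=> mf mf' gt; apply/funext => n; apply: has_sum_zsum.
have := has_sumZD c (has_sum_conv mf gt n) (has_sum_conv mf' gt n).
by congr has_sum; apply/funext => k; rewrite !fctE /= mulrDl mulrA.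
Qed.

Lemma conv_linr (c : R[i]) f g g' t t' : l1 f -> (forall m, cmod (g m) <= t) ->
  (forall m, cmod (g' m) <= t') ->
  conv f (c \*o g + g') = c \*o conv f g + conv f g'.
Proof.
move=> mf gt gt'; apply/funext => n; apply: has_sum_zsum.
have := has_sumZD c (has_sum_conv mf gt n) (has_sum_conv mf gt' n).
by congr has_sum; apply/funext => k; rewrite !fctE /= mulrDr mulrCA.
Qed.

Lemma conv_delta k g n : conv (delta k) g n = g (n - k).
Proof.
apply: has_sum_zsum; have -> : g (n - k) =
    \sum_(j <- [fset k]%fset) delta k j * g (n - j).
  by rewrite big_seq_fset1 /delta eqxx mul1r.
apply: has_sum_finite => j; rewrite inE /delta => /negbTE ->.
by rewrite mul0r.
Qed.

Lemma conv_delta0 g : conv (delta 0) g = g.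
Proof. by apply/funext => n; rewrite conv_delta subr0. Qed.

Lemma deltaD m n : delta (m + n) = conv (delta m) (delta n) :> (int -> R[i]).
Proof. by apply/funext => k; rewrite conv_delta /delta subr_eq addrC. Qed.

Definition wcmod (w : int -> R) f (n : int) : R[i] := (cmod (f n) * w n)%:C%C.

Lemma cmod_wcmod w f n : 0 <= w n -> cmod (wcmod w f n) = cmod (f n) * w n.
Proof. by move=> w0; rewrite cmod_real ger0_norm// mulr_ge0 ?cmod_ge0. Qed.

Lemma lpball_wcmod_l1 s f : l1ball s f -> l1ball s (wcmod (fun=> 1) f).
Proof.
move=> /l1ballP fs; apply/l1ballP => A.
by under eq_bigr do rewrite cmod_wcmod// mulr1.
Qed.

Lemma cmod_conv_weight_le (w : int -> R) (K : R) f g s t n :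
  (forall n, 0 < w n) -> 0 <= K ->
  (forall m n : int, w (m + n) <= K * (w m + w n)) -> l1 f -> l1 g ->
  (forall m, cmod (wcmod w f m) <= s) -> (forall m, cmod (wcmod w g m) <= t) ->
  cmod (conv f g n) * w n <=
  K * cmod ((conv (wcmod (fun=> 1) g) (wcmod w f) +
             conv (wcmod (fun=> 1) f) (wcmod w g)) n).
Proof.
move=> w_gt0 K0 w_sub mf mg wf wg; set v := _ + _.
have l1_wcmod h : l1 h -> l1 (wcmod (fun=> 1) h).
  by move=> [r hr]; exists r; exact: lpball_wcmod_l1.
have vn : has_sum (fun k => (cmod (f k) * cmod (g (n - k)) * (w k + w (n - k)))%:C%C) (v n).
  have := has_sumZD 1 (has_sum_convC (l1_wcmod g mg) wf n)
                             (has_sum_conv (l1_wcmod f mf) wg n).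
  rewrite mul1r; congr has_sum; apply/funext => k.
  by rewrite fctE /= mul1r /wcmod !mulr1 -!rmorphM -rmorphD; congr (_%:C%C); ring.
have [r gr] := mg.
have g_r m : cmod (g m) <= r by exact: lpball_cmod_le gr.
rewrite -ler_pdivlMr//; apply: (has_sum_cmod_le (has_sum_conv mf g_r n)) => A.
rewrite ler_pdivlMr// mulr_suml.
have v_ge := sum_le_has_sum A _ vn.
apply: le_trans (ler_wpM2l K0 (v_ge _)); last first.
  by move=> k; rewrite !mulr_ge0 ?cmod_ge0 ?addr_ge0// ltW.
rewrite mulr_sumr; apply: ler_sum => k _; rewrite cmodM mulrCA.
by rewrite ler_wpM2l ?mulr_ge0 ?cmod_ge0// -{1}(subrKC k n).
Qed.

Section Weighted.
Variable p : R.
Hypothesis p_ge1 : 1 <= p.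

Lemma lpball_shift (w : int -> R) c s f k : (forall n, 0 < w n) -> 0 <= c ->
  (forall n, w (n + k) <= c * w n) ->
  lpball p w s f -> lpball p w (c * s) (fun n => f (n - k)).
Proof.
move=> w_gt0 c0 wk; apply: (lpball_dom p_ge1 w_gt0 (h := fun n => n - k)) => //.
- by move=> m n /addIr.
- by move=> n; exact: ltW.
- by move=> n; rewrite mulrCA ler_wpM2l ?cmod_ge0// -{1}(subrK k n).
Qed.

(* Young's inequality: [conv f g] is a combination of translates of [g]. *)
Lemma lpball_conv_l1 f g s t : l1ball s f -> lpball p (fun=> 1) t g ->
  lpball p (fun=> 1) (s * t) (conv f g).
Proof.
move=> fs gt; have t0 := lpball_ge0 gt.
have g_le n : cmod (g n) <= t by exact: lpball_cmod_le gt.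
have finite_sum (r : seq int) : lpball p (fun=> 1) ((\sum_(k <- r) cmod (f k)) * t)
    (fun n : int => \sum_(k <- r) f k * g (n - k)).
  elim: r => [|k r IHr].
    rewrite big_nil mul0r (_ : (fun n => \sum_(k <- [::]) _) = 0); first exact: lpball0.
    by apply/funext => n; rewrite big_nil.
  rewrite big_cons mulrDl (_ : (fun n => _) = f k \*o (fun n => g (n - k)) +
      (fun n => \sum_(j <- r) f j * g (n - j))); last first.
    by apply/funext => n; rewrite big_cons.
  apply: lpballD IHr => //; apply: lpballZ => //.
  by rewrite -[t]mul1r; apply: lpball_shift => // n; rewrite mul1r.
apply: (@lpball_ccvg _ _ _ _ p_ge1 one_gt0 _ totally (totally_filter) _
  (fun A (n : int) => \sum_(k <- A) f k * g (n - k))) => [n|].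
  by apply: has_sum_conv g_le n; exists s.
apply: (@near_totally _ _ fset0) => A _; apply: lpball_le (finite_sum A).
by rewrite ler_wpM2r//; move/l1ballP: fs; exact.
Qed.

Lemma lpball_wcmod (w : int -> R) s f : (forall n, 0 < w n) ->
  lpball p w s f -> lpball p (fun=> 1) s (wcmod w f).
Proof.
move=> w_gt0; rewrite -[X in lpball _ _ X (wcmod _ _)]mul1r.
apply: (lpball_dom p_ge1 w_gt0 (h := id)) => // n.
by rewrite cmod_wcmod ?mulr1 ?mul1r// ltW.
Qed.

Lemma lpball_conv (w : int -> R) (K : R) f g s s' t t' :
  (forall n, 0 < w n) -> 0 <= K ->
  (forall m n : int, w (m + n) <= K * (w m + w n)) ->
  lpball p w s f -> l1ball s' f -> lpball p w t g -> l1ball t' g ->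
  lpball p w (K * (s * t' + s' * t)) (conv f g).
Proof.
move=> w_gt0 K0 w_sub fs fs' gt gt'.
have wf := lpball_wcmod w_gt0 fs; have wg := lpball_wcmod w_gt0 gt.
have := lpballD p_ge1 one_gt0
  (lpball_conv_l1 (lpball_wcmod_l1 gt') wf) (lpball_conv_l1 (lpball_wcmod_l1 fs') wg).
rewrite [t' * s]mulrC; apply: (lpball_dom p_ge1 one_gt0 (h := id)) => // n.
  exact: ltW.
rewrite mulr1; apply: cmod_conv_weight_le => //; [by exists s'|by exists t'|..] => m.
- exact: lpball_cmod_le wf.
- exact: lpball_cmod_le wg.
Qed.

End Weighted.

End Convolution.

(** * Characters of the convolution algebra *)

Section RootsOfUnity.
Variable R : realType.

(* Iterated square roots of [-1]. *)
Lemma prim_root_exp2_exists m : exists z : R[i], (2 ^ m.+1).-primitive_root z.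
Proof.
have [z zN1] : exists z : R[i], z ^+ (2 ^ m) = -1.
  elim: m => [|m [z zN1]]; first by exists (-1); rewrite expr1.
  by exists (sqrtc z); rewrite expnS exprM sqr_sqrtc.
exists z; have z1 : z ^+ (2 ^ m.+1) = 1 by rewrite expnSr exprM zN1 sqrrN expr1n.
have exp2_gt0 : (0 < 2 ^ m.+1)%N by rewrite expn_gt0.
have [k prim_z /dvdn_pfactor[//|j jm kE]] := prim_order_exists exp2_gt0 z1.
move: prim_z; rewrite {}kE; move: jm; rewrite leq_eqVlt => /predU1P[-> //|jm prim_z].
have := zN1; rewrite -(subnK (ltnSE jm)) addnC expnD exprM (prim_expr_order prim_z).
by rewrite expr1n => /eqP; rewrite -subr_eq0 opprK (pnatr_eq0 _ 2).
Qed.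

Lemma sum_prim_root_expz N (z : R[i]) (d : int) : N.-primitive_root z ->
  ~~ (N %| `|d|)%N -> \sum_(j < N) (z ^ d) ^+ j = 0.
Proof.
move=> prim_z Nd; apply/eqP; have z_d : z ^ d != 1.
  apply: contra Nd => /eqP zd1; rewrite (prim_order_dvd prim_z).
  case: d zd1 => k; first by rewrite -exprnP => ->.
  by rewrite NegzE -exprnN /= => /eqP; rewrite invr_eq1.
have := subrX1 (z ^ d) N; rewrite exprnP exprzAC -exprnP (prim_expr_order prim_z).
rewrite exp1rz subrr => /esym/eqP; rewrite mulf_eq0 subr_eq0.
by rewrite (negbTE z_d).
Qed.

End RootsOfUnity.

Definition chi {R : realType} (z : R[i]) (f : int -> R[i]) : R[i] :=
  zsum (fun n => f n * z ^ n).

Section Characters.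
Variable R : realType.
Implicit Types (f g : int -> R[i]) (s : R) (z : R[i]).
#[local] Existing Instance totally_filter.

Let one_gt0 (n : int) : 0 < (1 : R). Proof. exact: ltr01. Qed.

Lemma l1ball_chi_term z f s : cmod z = 1 -> l1ball s f ->
  l1ball s (fun n => f n * z ^ n).
Proof.
move=> z1 /l1ballP fs; apply/l1ballP => A; under eq_bigr do rewrite cmodM.
by under eq_bigr do rewrite cmod_exprz z1 exp1rz mulr1.
Qed.

Lemma has_sum_chi z f : cmod z = 1 -> l1 f ->
  has_sum (fun n => f n * z ^ n) (chi z f).
Proof.
by move=> z1 [s fs]; apply: has_sum_zsum_l1; exists s; exact: l1ball_chi_term.
Qed.

Lemma cmod_chi_le z f s : cmod z = 1 -> l1ball s f -> cmod (chi z f) <= s.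
Proof. by move=> z1 fs; apply: cmod_zsum_le; exact: l1ball_chi_term. Qed.

Lemma chiZD z (c : R[i]) f g : cmod z = 1 -> l1 f -> l1 g ->
  chi z (c \*o f + g) = c * chi z f + chi z g.
Proof.
move=> z1 mf mg; apply: has_sum_zsum.
have := has_sumZD c (has_sum_chi z1 mf) (has_sum_chi z1 mg).
by congr has_sum; apply/funext => n; rewrite !fctE /= mulrDl mulrA.
Qed.

Lemma chiB z f g : cmod z = 1 -> l1 f -> l1 g ->
  chi z (f - g) = chi z f - chi z g.
Proof.
by move=> z1 mf mg; rewrite addrC -mulN1_fun chiZD// mulN1r addrC.
Qed.

Lemma chi_finite z f (A : {fset int}) : (forall n, n \notin A -> f n = 0) ->
  chi z f = \sum_(n <- A) f n * z ^ n.
Proof.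
move=> fA; apply: has_sum_zsum; apply: has_sum_finite => n /fA ->.
by rewrite mul0r.
Qed.

Lemma chi0 z : chi z (0 : int -> R[i]) = 0.
Proof. by rewrite (chi_finite z (A := fset0))// big_seq_fset0. Qed.

Lemma chiZ z (c : R[i]) f : cmod z = 1 -> l1 f -> chi z (c \*o f) = c * chi z f.
Proof.
move=> z1 mf; have := chiZD c z1 mf (lpw0 _ (lexx 1)).
by rewrite chi0 !addr0.
Qed.

Lemma chi_delta z k : chi z (delta k) = z ^ k.
Proof.
rewrite (chi_finite z (A := [fset k]%fset)) => [|n].
  by rewrite big_seq_fset1 /delta eqxx mul1r.
by rewrite inE /delta => /negbTE ->.
Qed.

Lemma chi_delta_conv z k g : cmod z = 1 -> l1 g ->
  chi z (conv (delta k) g) = z ^ k * chi z g.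
Proof.
move=> z1 mg; have z0 : z != 0 by rewrite -cmod_gt0 z1.
apply: has_sum_zsum.
have subK : cancel (fun n : int => n + k) (fun n => n - k) by move=> n; rewrite addrK.
have addK : cancel (fun n : int => n - k) (fun n => n + k) by move=> n; rewrite subrK.
have := has_sumZ (z ^ k) (has_sum_reindex subK addK (has_sum_chi z1 mg)).
congr has_sum; apply/funext => n; rewrite /= conv_delta.
by rewrite mulrCA -expfzDr// subrKC.
Qed.

Lemma ccvg_chi (T : Type) (F : set_system T) (FF : ProperFilter F) z u f :
  cmod z = 1 -> (forall x, l1 (u x)) -> l1 f -> lpcvg 1 (fun=> 1) F u f ->
  ccvg F (fun x : T => chi z (u x)) (chi z f).
Proof.
move=> z1 mu mf uf; apply/ccvgP => e /uf; apply: filterS => x ufx.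
by rewrite -chiB//; exact: cmod_chi_le.
Qed.

Lemma l1_conv f g : l1 f -> l1 g -> l1 (conv f g).
Proof. by move=> [s fs] [t gt]; exists (s * t); exact: lpball_conv_l1. Qed.

Lemma chi_conv z f g : cmod z = 1 -> l1 f -> l1 g ->
  chi z (conv f g) = chi z f * chi z g.
Proof.
move=> z1 mf mg; have [t gt] := mg.
have g_le n : cmod (g n) <= t by exact: lpball_cmod_le gt.
have conv_g_lin : lin_on l1 (conv^~ g).
  by move=> c f1 f2 mf1 mf2; exact: conv_linl g_le.
have l1_finsupp (h : int -> R[i]) : finsupp h -> l1 h by exact: lpw_finsupp.
have chi_conv_finsupp (h : int -> R[i]) : finsupp h -> chi z (conv h g) = chi z h * chi z g.
  move: h; apply: finsupp_ind => [|c k h /l1_finsupp mh IHh].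
    rewrite (lin_on0 conv_g_lin) ?chi0 ?mul0r//; exact: lpw0.
  have mk := l1_finsupp _ (finsupp_delta R k).
  rewrite conv_g_lin// !chiZD//; try exact: l1_conv.
  by rewrite IHh chi_delta_conv// chi_delta; ring.
have fA := lpcvg_trunc (lexx 1) mf.
have mA A : l1 (trunc A f) := l1_finsupp _ (finsupp_trunc A f).
have conv_fA : lpcvg 1 (fun=> 1) totally (fun A => conv (trunc A f) g) (conv f g).
  apply: (lpcvg_bounded_lin (lexx 1) one_gt0 _ conv_g_lin _ mA mf fA).
  exists t => [|h s _ hs]; first exact: lpball_ge0 gt.
  by rewrite mulrC; exact: lpball_conv_l1.
apply: (ccvg_unique
  (ccvg_chi _ z1 (fun A => l1_conv (mA A) mg) (l1_conv mf mg) conv_fA)).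
rewrite mulrC (_ : (fun A => _) = fun A => chi z g * chi z (trunc A f)).
  exact: ccvgZ (ccvg_chi _ z1 mA mf fA).
by apply/funext => A; rewrite chi_conv_finsupp 1?mulrC//; exact: finsupp_trunc.
Qed.

Lemma finsupp_coef_chi M N z f n : N.-primitive_root z -> (M.*2 < N)%N ->
  (`|n| <= M)%N -> f = trunc (win M) f ->
  N%:R * f n = \sum_(j < N) chi (z ^+ j) f * (z ^+ j) ^ (- n).
Proof.
move=> prim_z MN nM fM.
have z0 : z != 0 by rewrite (prim_root_eq0 prim_z) -lt0n (leq_ltn_trans _ MN).
have chi_f j : chi (z ^+ j) f * (z ^+ j) ^ (- n) =
    \sum_(m <- win M) f m * (z ^ (m - n)) ^+ j.
  rewrite (chi_finite _ (A := win M)) => [|m nm]; last by rewrite fM trunc_notin.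
  rewrite mulr_suml; apply: eq_bigr => m _; rewrite -mulrA; congr (_ * _).
  by rewrite -expfzDr ?expf_neq0// [RHS]exprnP -exprzAC -exprnP.
under eq_bigr do rewrite chi_f; rewrite exchange_big /=.
under eq_bigr do rewrite -mulr_sumr.
rewrite (big_fsetD1 n) ?mem_win//= subrr expr0z.
under eq_bigr do rewrite expr1n.
rewrite sumr_const card_ord mulrC big_seq big1 ?addr0// => m.
rewrite !inE mem_win => /andP[mn mM]; rewrite sum_prim_root_expz ?mulr0//.
apply/negP => /dvdn_leq; lia.
Qed.

Lemma cmod_prim_root N z : N.-primitive_root z -> cmod z = 1.
Proof.
move=> prim_z; apply/eqP; rewrite -(pexpr_eq1 (prim_order_gt0 prim_z)) ?cmod_ge0//.
have := congr1 cmod (prim_expr_order prim_z); rewrite cmod1 exprnP cmod_exprz => /eqP.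
by [].
Qed.

Lemma cmod_coef_le f (B : R) n : l1 f ->
  (forall z, cmod z = 1 -> cmod (chi z f) <= B) -> cmod (f n) <= B.
Proof.
move=> mf fB; apply/ler_addgt0Pr => e e0.
have fM : \forall M \near \oo, l1ball e (trunc (win M) f - f).
  exact: cvg_win (lpcvg_trunc (lexx 1) mf e0).
have [M [fMe nM]] := filter_ex (filterI fM (nbhs_infty_ge `|n|%N)).
have [z prim_z] := prim_root_exp2_exists R M.
set N := (2 ^ M.+1)%N in prim_z; have MN : (M.*2 < N)%N.
  by rewrite /N expnS mul2n ltn_double ltn_expl.
have N0 : 0 < N%:R :> R by rewrite ltr0n (leq_ltn_trans _ MN).
have z1 := cmod_prim_root prim_z.
have zj1 (j : nat) : cmod (z ^+ j) = 1 by rewrite exprnP cmod_exprz z1 exp1rz.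
have mM : l1 (trunc (win M) f) by apply: lpw_finsupp => //; exact: finsupp_trunc.
have chi_le (j : nat) : cmod (chi (z ^+ j) (trunc (win M) f)) <= B + e.
  rewrite -(subrK (chi (z ^+ j) f) (chi _ (trunc _ _))) addrC.
  rewrite (le_trans (ler_cmodD _ _))// lerD ?fB// -chiB//.
  exact: cmod_chi_le.
have := finsupp_coef_chi prim_z MN nM; move=> /(_ (trunc (win M) f)).
rewrite truncE ?mem_win// => /(_ _)/wrap[|/(congr1 (@cmod R))].
  by apply/funext => m; rewrite /trunc; case: ifP.
rewrite cmodM (_ : cmod N%:R = N%:R) ?(cmod_int R N)// => coef_eq.
rewrite -(ler_pM2l N0) coef_eq (le_trans (ler_cmod_sum _ _))//.
rewrite [leRHS](_ : _ = \sum_(j < N) (B + e)); last first.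
  by rewrite sumr_const card_ord mulr_natl.
by apply: ler_sum => j _; rewrite cmodM cmod_exprz zj1 exp1rz mulr1.
Qed.

Lemma chi_inj f g : l1 f -> l1 g ->
  (forall z, cmod z = 1 -> chi z f = chi z g) -> f = g.
Proof.
move=> mf mg fg; apply/funext => n; apply/eqP; rewrite -subr_eq0.
apply/eqP/cmod_eq0/eqP; rewrite eq_le cmod_ge0 andbT.
apply: (cmod_coef_le (f := f - g)) => [|z z1]; first exact: lpwB.
by rewrite chiB// fg// subrr cmod0.
Qed.

End Characters.

(** * Automatic continuity *)

Definition weakly_subadditive {R : realType} (w : int -> R) : Prop :=
  exists2 K : R, 0 <= K & forall m n : int, w (m + n) <= K * (w m + w n).

Definition l1_embedded {R : realType} (p : R) (w : int -> R) : Prop :=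
  exists2 C : R, 0 <= C & forall s f, lpball p w s f -> l1ball (C * s) f.

Definition character_on {R : realType} (P : (int -> R[i]) -> Prop)
    (phi : (int -> R[i]) -> R[i]) : Prop :=
  (forall (c : R[i]) f g, P f -> P g -> phi (c \*o f + g) = c * phi f + phi g) /\
  (forall f g, P f -> P g -> phi (conv f g) = phi f * phi g).

Definition alg_hom {R : realType} (P Q : (int -> R[i]) -> Prop)
    (T : (int -> R[i]) -> int -> R[i]) : Prop :=
  [/\ forall f, P f -> Q (T f), lin_on P T &
      forall f g, P f -> P g -> T (conv f g) = conv (T f) (T g)].

Section BanachAlgebra.
Variables (R : realType) (p : R) (w : int -> R).
Hypotheses (p_ge1 : 1 <= p) (w_gt0 : forall n, 0 < w n).
Hypotheses (w_subadd : weakly_subadditive w) (w_l1 : l1_embedded p w).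
Implicit Types (f g : int -> R[i]) (s t : R).

Lemma lpw_l1 f : lpw p w f -> l1 f.
Proof. by have [C _ fC] := w_l1; move=> [s /fC fs]; exists (C * s). Qed.

Lemma lpball_conv_submult : exists2 K, 0 <= K & forall f g s t,
  lpball p w s f -> lpball p w t g -> lpball p w (K * s * t) (conv f g).
Proof.
have [[K K0 wK] [C C0 fC]] := (w_subadd, w_l1).
exists (2 * K * C) => [|f g s t fs gt]; first by rewrite !mulr_ge0.
have := lpball_conv p_ge1 w_gt0 K0 wK fs (fC _ _ fs) gt (fC _ _ gt).
by congr lpball; ring.
Qed.

Lemma lpw_conv f g : lpw p w f -> lpw p w g -> lpw p w (conv f g).
Proof.
have [K _ fgK] := lpball_conv_submult.
by move=> [s fs] [t gt]; exists (K * s * t); exact: fgK.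
Qed.

Lemma lin_on_conv f : l1 f -> lin_on (lpw p w) (conv f).
Proof.
move=> mf c g h /lpw_l1[s gs] /lpw_l1[t ht].
apply: (conv_linr c mf (t := s) (t' := t)) => n.
  exact: lpball_cmod_le gs.
exact: lpball_cmod_le ht.
Qed.

(* If [phi f] were large, the solution of [x = f / phi f + (f / phi f) * x] given by
   the Neumann series would satisfy [phi x = 1 + phi x]. *)
Lemma character_bounded : exists K, forall phi, character_on (lpw p w) phi ->
  forall f s, lpball p w s f -> cmod (phi f) <= K * s.
Proof.
have [K K0 fgK] := lpball_conv_submult; exists K => phi [phi_lin phi_conv] f s fs.
rewrite leNgt; apply/negP => phi_large; have s0 := lpball_ge0 fs.
have phi_gt0 : 0 < cmod (phi f) by apply: le_lt_trans phi_large; exact: mulr_ge0.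
have phi_neq0 : phi f != 0 by rewrite -cmod_gt0.
have phi0 : phi 0 = 0.
  have := phi_lin (-1) 0 0 (lpw0 w p_ge1) (lpw0 w p_ge1).
  by rewrite mulN1_fun oppr0 addr0 mulN1r addNr.
pose r := (phi f)^-1 \*o f.
have r_ball := lpballZ p_ge1 w_gt0 (phi f)^-1 fs.
have mf : lpw p w f by exists s.
have mr : lpw p w r by eexists; exact: r_ball.
have phi_r : phi r = 1.
  have := phi_lin (phi f)^-1 f 0 mf (lpw0 w p_ge1).
  by rewrite phi0 !addr0 mulVf.
have K_small : 0 <= K * (cmod (phi f)^-1 * s) < 1.
  rewrite cmodV !mulr_ge0 ?invr_ge0 ?(ltW phi_gt0)//=.
  by rewrite mulrCA ltr_pdivrMl// mulr1.
have [|x mx x_eq] := neumann p_ge1 w_gt0 K_small (lin_on_conv (lpw_l1 mr)) _ mr.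
  by move=> g t; exact: fgK r_ball.
have := phi_lin 1 r (conv r x) mr (lpw_conv mr mx).
rewrite mul1_fun -x_eq phi_conv// phi_r !mul1r => /eqP.
by rewrite -subr_eq0 opprD addrCA subrr addr0 oppr_eq0 oner_eq0.
Qed.

Lemma alg_hom_bounded (v : int -> R) (T : (int -> R[i]) -> int -> R[i]) :
  (forall n, 0 < v n) -> l1_embedded p v ->
  alg_hom (lpw p w) (lpw p v) T -> bounded_on (lpw p w) p w v T.
Proof.
move=> v_gt0 [C _ gC] [T_lpw T_lin T_conv].
have T_l1 f : lpw p w f -> l1 (T f) by move=> /T_lpw[s /gC]; exists (C * s).
have [K phiK] := character_bounded.
apply: bounded_on_coord => // n; exists K => f s fs.
apply: cmod_coef_le => [|z z1]; first by apply: T_l1; exists s.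
apply: (phiK (chi z \o T)) fs; split=> [c g h mg mh|g h mg mh] /=.
  by rewrite T_lin// chiZD//; exact: T_l1.
by rewrite T_conv// chi_conv//; exact: T_l1.
Qed.

Lemma alg_hom_delta0 (v : int -> R) (T : (int -> R[i]) -> int -> R[i]) :
  (forall n, 0 < v n) -> alg_hom (lpw p w) (lpw p v) T -> l1_embedded p v ->
  (forall h : int -> R[i], lpw p v h -> exists2 f : int -> R[i], lpw p w f & T f = h) ->
  T (delta 0) = delta 0.
Proof.
move=> v_gt0 [T_lpw _ T_conv] [C _ gC] T_surj.
have lpw_delta0 (u : int -> R) : (forall n, 0 < u n) -> lpw p u (delta 0).
  by move=> u_gt0; exact: (lpw_finsupp p_ge1 u_gt0 (finsupp_delta R 0)).
have [e me Te] := T_surj _ (lpw_delta0 v v_gt0).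
have [s /gC Ts] := T_lpw _ (lpw_delta0 w w_gt0).
have l1_delta0 : l1 (delta (0 : int)) :=
  lpw_finsupp (lexx 1) (fun=> ltr01) (finsupp_delta R 0).
have T_le n : cmod (T (delta 0) n) <= C * s by exact: lpball_cmod_le Ts.
rewrite -[LHS]conv_delta0 -(convC l1_delta0 T_le) -{2}Te -T_conv//.
  by rewrite conv_delta0.
exact: lpw_delta0.
Qed.

End BanachAlgebra.

(** * Polynomial weights *)

Section PolynomialWeights.
Variable R : realType.
Implicit Types (a b q : R) (m n : int).

Lemma omega_ge1 a n : 1 <= omega a n.
Proof. by rewrite /omega le_max lexx. Qed.

Lemma omega_gt0 a n : 0 < omega a n.
Proof. exact: lt_le_trans ltr01 (omega_ge1 a n). Qed.

Lemma omegaN a n : omega a (- n) = omega a n.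
Proof. by rewrite /omega normrN. Qed.

Lemma omega0 : omega (0 : R) = fun=> 1.
Proof. by apply/funext => n; rewrite /omega powRr0 maxxx. Qed.

Let norm_ge1 n : n != 0 -> 1 <= `|n|%:~R :> R.
Proof. by move=> n0; rewrite (_ : 1 = 1%:~R)// ler_int; lia. Qed.

Lemma omega_neq0 a n : 0 <= a -> n != 0 -> omega a n = `|n|%:~R `^ a.
Proof.
move=> a0 n0; apply: max_r.
by rewrite -[leLHS](powRr0 (`|n|%:~R : R)) ler_powR ?norm_ge1.
Qed.

Lemma omega_at0 a : 0 <= a -> omega a 0 = 1.
Proof.
rewrite le_eqVlt => /predU1P[<-|a0]; first by rewrite omega0.
by rewrite /omega normr0 powR0 ?gt_eqF// max_l.
Qed.

Lemma le_omega a b n : 0 <= a -> a <= b -> omega a n <= omega b n.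
Proof.
move=> a0 ab; have b0 := le_trans a0 ab.
have [->|n0] := eqVneq n 0; first by rewrite !omega_at0.
by rewrite !omega_neq0// ler_powR// norm_ge1.
Qed.

Lemma omegaS a n : 0 <= a -> n != 0 -> omega (a + 1) n = `|n|%:~R * omega a n.
Proof.
move=> a0 n0; rewrite !omega_neq0 ?addr_ge0//.
by rewrite powRD ?powRr1 1?mulrC// intr_eq0 normr_eq0 n0 implybT.
Qed.

Lemma omegaS_ge a n : 0 <= a -> `|n|%:~R * omega a n <= omega (a + 1) n.
Proof.
move=> a0; have [->|n0] := eqVneq n 0; last by rewrite omegaS.
by rewrite normr0 mul0r ltW// omega_gt0.
Qed.

Lemma omegaD_le a m n : 0 <= a -> omega a (m + n) <= 2 `^ a * (omega a m + omega a n).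
Proof.
move=> a0; have pow2_ge1 : 1 <= 2 `^ a :> R.
  by rewrite -[leLHS](powRr0 (2 : R)) ler_powR// ler1n.
wlog mn : m n / `|m| <= `|n|.
  move=> wlog_mn; case/orP: (le_total `|m| `|n|) => /wlog_mn //.
  by rewrite addrC [omega a n + _]addrC.
apply: (@le_trans _ _ (2 `^ a * omega a n)); last first.
  by rewrite ler_wpM2l ?powR_ge0// lerDr ltW// omega_gt0.
rewrite {1}/omega ge_max; apply/andP; split.
  by rewrite (le_trans (omega_ge1 a n))// ler_peMl// ltW// omega_gt0.
apply: (@le_trans _ _ (2 `^ a * `|n|%:~R `^ a)); last first.
  by rewrite ler_wpM2l ?powR_ge0// /omega le_max lexx orbT.
rewrite -powRM ?ler0z// ge0_ler_powR ?nnegrE ?mulr_ge0 ?ler0z//.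
by rewrite -(intrM R 2) ler_int; lia.
Qed.

Lemma omega_subr1_le a n : 0 <= a -> omega a (n - 1) <= 2 `^ a * 2 * omega a n.
Proof.
move=> a0; apply: le_trans (omegaD_le n (- 1) a0) _.
rewrite -mulrA ler_wpM2l ?powR_ge0// omegaN mulr_natl mulr2n lerD2l.
by rewrite omega_neq0// powR1 omega_ge1.
Qed.

Lemma omega_weakly_subadditive a : 0 <= a -> weakly_subadditive (omega a).
Proof. by move=> a0; exists (2 `^ a); [exact: powR_ge0|move=> m n; exact: omegaD_le]. Qed.

Lemma omega_powR a q n : 0 <= a -> 0 <= q -> omega a n `^ q = omega (a * q) n.
Proof.
move=> a0 q0; have [->|n0] := eqVneq n 0.
  by rewrite !omega_at0 ?powR1// mulr_ge0.
by rewrite !omega_neq0 ?mulr_ge0// -powRrM.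
Qed.

Section ZetaSum.
Variable a : R.
Hypothesis a_gt1 : 1 < a.

Let b_gt0 : 0 < a - 1. Proof. by rewrite subr_gt0. Qed.

(* The mean value bound [b n^(-a) <= (n-1)^(-b) - n^(-b)] with [b = a - 1], written
   with [1 + b x <= exp (b x)]. *)
Lemma powRN_telescope (n : nat) : (0 < n)%N ->
  n.+1%:R `^ (- a) <= (a - 1)^-1 * (n%:R `^ (- (a - 1)) - n.+1%:R `^ (- (a - 1))) :> R.
Proof.
move=> n0; have nR : 0 < n%:R :> R by rewrite ltr0n.
have n1R : 0 < n.+1%:R :> R by rewrite ltr0n.
rewrite ler_pdivlMl//; set b := a - 1.
have powR_ratio : n%:R `^ (- b) = n.+1%:R `^ (- b) * (n.+1%:R / n%:R) `^ b :> R.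
  rewrite powRM ?invr_ge0 ?ltW// mulrA -powRD; last first.
    by rewrite (gt_eqF n1R) implybT.
  by rewrite addNr powRr0 mul1r -powR_inv1 ?ltW// -powRrM mulN1r.
have ratio_ge : 1 + b / n.+1%:R <= (n.+1%:R / n%:R) `^ b :> R.
  rewrite /powR gt_eqF ?divr_gt0//; apply: le_trans (expR_ge1Dx _).
  rewrite lerD2l ler_wpM2l ?(ltW b_gt0)//.
  rewrite ln_div ?posrE// -opprB -ln_div ?posrE// lerNr.
  have -> : n%:R / n.+1%:R = 1 + - n.+1%:R^-1 :> R.
    have n1_neq0 : n%:R + 1 != 0 :> R by rewrite natr1 gt_eqF.
    by rewrite -natr1; field.
  apply: le_ln1Dx; rewrite ltrN2 invf_lt1// ltr1n; lia.
rewrite powR_ratio -[X in _ - X]mulr1 -mulrBr.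
have -> : n.+1%:R `^ (- a) = n.+1%:R `^ (- b) / n.+1%:R :> R.
  rewrite (_ : - a = - b - 1); last by rewrite /b; ring.
  by rewrite powRB ?(gt_eqF n1R) ?implybT// powRr1// ltW.
by rewrite mulrCA ler_wpM2l ?powR_ge0// lerBrDl.
Qed.

Lemma sum_win_omegaV_le N : \sum_(n <- win N.+1) (omega a n)^-1 <=
  3 + 2 / (a - 1) * (1 - N.+1%:R `^ (- (a - 1))).
Proof.
have a0 : 0 <= a := ltW (lt_trans ltr01 a_gt1).
have omegaV (n : nat) : (omega a n.+1%:Z)^-1 = n.+1%:R `^ (- a).
  by rewrite omega_neq0// powRN.
elim: N => [|N IHN].
  rewrite big_winS big_win0 omegaN (omegaV 0%N) (omega_at0 a0).
  by rewrite !powR1 subrr mulr0 invr1; lra.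
rewrite big_winS omegaN omegaV; have := @powRN_telescope N.+1 isT.
move: IHN; set S := \sum_(n <- _) _; set u := _ `^ (- a).
set x := N.+1%:R `^ _; set y := N.+2%:R `^ _ => S_le u_le.
have -> : 3 + 2 / (a - 1) * (1 - y) =
    3 + 2 / (a - 1) * (1 - x) + 2 * ((a - 1)^-1 * (x - y)) by ring.
lra.
Qed.

Lemma sum_omegaV_bounded : exists Z : R, forall A : {fset int},
  \sum_(n <- A) (omega a n)^-1 <= Z.
Proof.
have c0 : 0 <= 2 / (a - 1) by rewrite divr_ge0// ltW.
exists (3 + 2 / (a - 1)) => A; have [N _ /(_ N.+1 (leqnSn N)) AN] := fsub_win A.
apply: le_trans (ler_sum_fsub _ AN) _ => [n|].
  by rewrite invr_ge0 ltW// omega_gt0.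
apply: le_trans (sum_win_omegaV_le N) _; rewrite lerD2l.
by rewrite ler_piMr// gerBl powR_ge0.
Qed.

End ZetaSum.

End PolynomialWeights.

Section L1Embedding.
Variables (R : realType) (p : R).

Lemma l1_embedded_p1 (w : int -> R) : (forall n, 1 <= w n) -> l1_embedded 1 w.
Proof.
move=> w_ge1; exists 1 => // s f.
have w_gt0 n : 0 < w n by exact: lt_le_trans ltr01 (w_ge1 n).
apply: (lpball_dom (lexx 1) w_gt0 (h := id)) => // n.
by rewrite mulr1 mul1r ler_peMr ?cmod_ge0.
Qed.

Lemma l1_embedded_conjugate (q : R) (w : int -> R) (Z : R) : 0 < p -> 0 < q ->
  p^-1 + q^-1 = 1 -> (forall n, 0 < w n) ->
  (forall A : {fset int}, \sum_(n <- A) (w n)^-1 `^ q <= Z) -> l1_embedded p w.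
Proof.
move=> p0 q0 pq w_gt0 wZ.
have Z0 : 0 <= Z by apply: le_trans (wZ fset0); rewrite big_seq_fset0.
exists (Z `^ q^-1) => [|s f /lpball_pnormP fs]; first exact: powR_ge0.
apply/l1ballP => A.
rewrite (eq_bigr (fun n => cmod (f n) * w n * (w n)^-1)) => [|n _]; last first.
  by rewrite mulfK// gt_eqF.
apply: le_trans (sumM_le_pnorm p0 A q0 pq _ _) _ => [n|n|].
- by rewrite mulr_ge0 ?cmod_ge0// ltW.
- by rewrite invr_ge0 ltW.
- rewrite mulrC ler_pM ?pnorm_ge0//.
  by rewrite pnorm_le ?powR_ge0// powRVK.
Qed.

Lemma l1_embedded_omega (a : R) : 1 < p -> 1 - p^-1 < a -> l1_embedded p (omega a).
Proof.
move=> p1 a_gt; have p0 : 0 < p by exact: lt_trans ltr01 p1.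
have pV_lt1 : p^-1 < 1 by rewrite invf_lt1.
pose q := (1 - p^-1)^-1; have q0 : 0 < q by rewrite invr_gt0 subr_gt0.
have a0 : 0 < a by rewrite (lt_trans _ a_gt)// subr_gt0.
have aq_gt1 : 1 < a * q by rewrite ltr_pdivlMr ?subr_gt0// mul1r.
have [Z sumZ] := sum_omegaV_bounded aq_gt1.
apply: (@l1_embedded_conjugate q _ Z) => // [|n|A]; first by rewrite invrK addrC subrK.
  exact: omega_gt0.
rewrite (eq_bigr (fun n => (omega (a * q) n)^-1))// => n _.
rewrite -omega_powR ?ltW// -powR_inv1 ?(ltW (omega_gt0 a n))//.
by rewrite -powRrM mulN1r powRN.
Qed.

Lemma alg_hom_omega_bounded (a : R) (T : (int -> R[i]) -> int -> R[i]) :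
  1 <= p -> 0 <= a -> l1_embedded p (omega a) ->
  alg_hom (lpw p (omega a)) (lpw p (omega a)) T ->
  bounded_on (lpw p (omega a)) p (omega a) (omega a) T.
Proof.
move=> p_ge1 a0 a_l1; apply: alg_hom_bounded => //; try exact: omega_gt0.
exact: omega_weakly_subadditive.
Qed.

End L1Embedding.

(** * The derivation *)

Section Membership.
Variables (R : realType) (p : R).
Hypothesis p_ge1 : 1 <= p.

Let p_gt0 : 0 < p. Proof. exact: lt_le_trans ltr01 p_ge1. Qed.

Lemma esum_leP (I : choiceType) (F : I -> R) (B : R) :
  (\esum_(i in [set: I]) (F i)%:E <= B%:E)%E <->
  forall A : {fset I}, \sum_(i <- A) F i <= B.
Proof.
split=> [FB A|FB].
  rewrite -lee_fin; apply: le_trans FB; apply: esum_ge; exists [set` A].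
    by split=> //; exact: finite_fset.
  by rewrite fsbig_finite//= set_fsetK sumEFin.
apply: ge_ereal_sup => _ [A [finA _] <-].
by rewrite fsbig_finite//= sumEFin lee_fin.
Qed.

Lemma lpball_esumP (w : int -> R) s f : 0 <= s -> lpball p w s f <->
  (\esum_(n in [set: int]) ((cmod (f n) * w n) `^ p)%:E <= (s `^ p)%:E)%E.
Proof.
by move=> s0; apply: iff_trans (lpballP w p_ge1 f s0) (iff_sym (esum_leP _ _)).
Qed.

Let esum_powR_ge0 (x : int -> R) : (0 <= \esum_(n in [set: int]) (x n `^ p)%:E)%E.
Proof. by apply: esum_ge0 => n _; rewrite lee_fin powR_ge0. Qed.

Lemma lpw_esumP (w : int -> R) f : lpw p w f <->
  (\esum_(n in [set: int]) ((cmod (f n) * w n) `^ p)%:E < +oo)%E.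
Proof.
split=> [[s fs]|].
  by apply: le_lt_trans (ltry _); apply/lpball_esumP/fs/lpball_ge0/fs.
set N := esum _ _ => N_fin; exists (fine N `^ p^-1).
have N0 : (0 <= N)%E := esum_powR_ge0 _.
apply/lpball_esumP; first exact: powR_ge0.
by rewrite powRVK ?fine_ge0// fineK// ge0_fin_numE.
Qed.

Lemma in_lpwE a : in_lpw p a = lpw p (omega a).
Proof. by apply/funext => f; apply/propext; rewrite lpw_esumP. Qed.

Lemma lp_sumE f : lp_sum p f = \esum_(n in [set: int]) ((cmod (f n) * 1) `^ p)%:E.
Proof. by apply: eq_esum => n _; rewrite mulr1. Qed.

Lemma in_lpE : in_lp p = lpw p (fun=> 1).
Proof. by apply/funext => f; apply/propext; rewrite lpw_esumP /in_lp lp_sumE. Qed.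

Lemma lpball_lp_norm f : in_lp p f -> lpball p (fun=> 1) (lp_norm p f) f.
Proof.
rewrite /in_lp /lp_norm => f_fin; apply/lpball_esumP; first exact: powR_ge0.
by rewrite -lp_sumE (powRVK p_gt0) ?fine_ge0 ?fineK ?ge0_fin_numE// lp_sumE.
Qed.

Lemma lp_norm_le f s : lpball p (fun=> 1) s f -> lp_norm p f <= s.
Proof.
move=> fs; have s0 := lpball_ge0 fs.
have := (lpball_esumP _ _ s0).1 fs; rewrite -lp_sumE => f_le.
have f_fin : lp_sum p f \is a fin_num.
  by rewrite ge0_fin_numE ?(le_lt_trans f_le) ?ltry// lp_sumE.
rewrite /lp_norm -(powRKV p_gt0 s0) ge0_ler_powR ?nnegrE ?invr_ge0 ?powR_ge0 ?(ltW p_gt0)//.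
  by rewrite fine_ge0// lp_sumE.
by rewrite -lee_fin fineK.
Qed.

End Membership.

(* [chi z] turns [fderiv] into [z d/dz]. *)
Definition fderiv {R : realType} (f : int -> R[i]) (n : int) : R[i] := n%:~R * f n.

(* At [n = 0] this is the junk value [f 0 / 0 = 0], as it should be. *)
Definition fint {R : realType} (f : int -> R[i]) (n : int) : R[i] := f n / n%:~R.

Section Derivation.
Variables (R : realType) (p : R).
Hypothesis p_ge1 : 1 <= p.
Implicit Types (f g : int -> R[i]) (s a : R).

Lemma fderiv_lin (c : R[i]) f g : fderiv (c \*o f + g) = c \*o fderiv f + fderiv g.
Proof. by apply/funext => n; rewrite /fderiv !fctE /= mulrDr mulrCA. Qed.

Lemma fderivB f g : fderiv (f - g) = fderiv f - fderiv g.
Proof. by apply/funext => n; rewrite /fderiv !fctE mulrBr. Qed.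

Lemma fderiv0 : fderiv (0 : int -> R[i]) = 0.
Proof. by apply/funext => n; exact: mulr0. Qed.

Lemma fderiv_delta n : fderiv (delta n) = n%:~R \*o delta n :> (int -> R[i]).
Proof.
apply/funext => m; rewrite /fderiv /delta /=.
by have [->|_] := eqVneq m n; rewrite ?mulr0.
Qed.

Lemma finsupp_fderiv f : finsupp f -> finsupp (fderiv f).
Proof.
move=> [A fA]; exists A; apply/funext => n; rewrite /trunc /fderiv.
by case: ifPn => // nA; rewrite fA trunc_notin// mulr0.
Qed.

Lemma finsupp_fint f : finsupp f -> finsupp (fint f).
Proof.
move=> [A fA]; exists A; apply/funext => n; rewrite /trunc /fint.
by case: ifPn => // nA; rewrite fA trunc_notin// mul0r.
Qed.

Lemma fintK f : f = f 0 \*o delta 0 + fderiv (fint f).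
Proof.
apply/funext => n; rewrite /fderiv /fint /delta !fctE /=.
have [->|n0] := eqVneq n 0; first by rewrite mulr1 mul0r addr0.
by rewrite mulr0 add0r mulrCA divff ?mulr1// intr_eq0.
Qed.

Lemma lpball_omega_le a b s f : 0 <= a -> a <= b ->
  lpball p (omega b) s f -> lpball p (omega a) s f.
Proof.
move=> a0 ab; rewrite -[X in lpball _ (omega a) X _]mul1r.
apply: (lpball_dom p_ge1 (omega_gt0 _) (h := id)) => // n.
  exact/ltW/omega_gt0.
by rewrite mul1r ler_wpM2l ?cmod_ge0 ?le_omega.
Qed.

Lemma lpball_conv_delta1 a s f : 0 <= a ->
  lpball p (omega a) s (conv (delta 1) f) -> lpball p (omega a) (2 `^ a * 2 * s) f.
Proof.
move=> a0 /(lpball_shift p_ge1 (k := -1) (omega_gt0 a)) fs.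
rewrite (_ : f = fun n => conv (delta 1) f (n - -1)).
  by apply: fs => [|n]; [rewrite mulr_ge0 ?powR_ge0|exact: omega_subr1_le].
by apply/funext => n; rewrite conv_delta opprK addrK.
Qed.

Lemma lpball_fderiv a s f : 0 <= a ->
  lpball p (omega (a + 1)) s f -> lpball p (omega a) s (fderiv f).
Proof.
move=> a0; rewrite -[X in lpball _ _ X (fderiv _)]mul1r.
apply: (lpball_dom p_ge1 (omega_gt0 _) (h := id)) => // n.
  exact/ltW/omega_gt0.
rewrite mul1r cmodM cmod_int mulrAC mulrC.
by rewrite ler_wpM2l ?cmod_ge0 ?omegaS_ge.
Qed.

Lemma lpball_fint a s f : 0 <= a ->
  lpball p (omega a) s f -> lpball p (omega (a + 1)) s (fint f).
Proof.
move=> a0; rewrite -[X in lpball _ _ X (fint _)]mul1r.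
apply: (lpball_dom p_ge1 (omega_gt0 _) (h := id)) => // n.
  exact/ltW/omega_gt0.
rewrite mul1r; have [->|n0] := eqVneq n 0.
  by rewrite /fint invr0 mulr0 cmod0 mul0r mulr_ge0 ?cmod_ge0// ltW// omega_gt0.
by rewrite omegaS// cmodM cmodV cmod_int mulrA divfK// intr_eq0 normr_eq0.
Qed.

Lemma fderiv_conv f g : l1 f -> l1 g -> l1 (fderiv f) -> l1 (fderiv g) ->
  fderiv (conv f g) = conv (fderiv f) g + conv f (fderiv g).
Proof.
move=> mf [t gt] mDf [t' Dgt]; apply/funext => n.
have g_le m : cmod (g m) <= t by exact: lpball_cmod_le gt.
have Dg_le m : cmod (fderiv g m) <= t' by exact: lpball_cmod_le Dgt.
apply: (has_sum_unique (has_sumZ n%:~R (has_sum_conv mf g_le n))).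
have := has_sumZD 1 (has_sum_conv mDf g_le n) (has_sum_conv mf Dg_le n).
rewrite mul1r; congr has_sum; apply/funext => k.
by rewrite !fctE /= /fderiv rmorphB /=; ring.
Qed.

End Derivation.

(* The ratio [b / a] is additive. *)
Lemma int_character_derivation (F : fieldType) (a b : int -> F) : a 0 = 1 ->
  (forall m n, a (m + n) = a m * a n) ->
  (forall m n, b (m + n) = b m * a n + a m * b n) ->
  exists c, forall n, b n = c * (n%:~R * a n).
Proof.
move=> a0 aD bD; have a_neq0 n : a n != 0.
  apply/eqP => an0; have := aD n (- n).
  by rewrite subrr a0 an0 mul0r => /eqP; rewrite oner_eq0.
pose c n := b n / a n.
have cD m n : c (m + n) = c m + c n by rewrite /c bD aD; field; rewrite !a_neq0.
have c0 : c 0 = 0 by have := cD 0 0; rewrite addr0 -[LHS]addr0 => /addrI/esym.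
have c_nat (m : nat) : c m = m%:R * c 1.
  elim: m => [|m IHm]; first by rewrite mul0r.
  by rewrite -addn1 PoszD cD IHm natrD mulrDl mul1r.
have c_int m : c m = m%:~R * c 1.
  case: m => m; first exact: c_nat.
  rewrite NegzE rmorphN mulNr /=; apply/eqP.
  by rewrite -addr_eq0 -[_%:~R]/(m.+1%:R) -c_nat -cD addNr c0.
by exists (c 1) => n; rewrite mulrCA mulrA -c_int divfK.
Qed.

Lemma lpball_absorb (R : realType) (I : choiceType) (p : R) (w : I -> R)
    (b : R) (f : I -> R[i]) : lpw p w f ->
  (forall t, lpball p w t f -> lpball p w (b + t / 2) f) -> lpball p w (2 * b) f.
Proof.
move=> [s fs] f_half.
have f_iter k : lpball p w (2 * b + (s - 2 * b) * 2^-1 ^+ k) f.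
  elim: k => [|k /f_half]; first by rewrite expr0 mulr1 addrC subrK.
  by congr lpball; rewrite exprS; field.
apply/lpball_pnormP => A; apply/ler_addgt0Pr => e e0.
have half_lt1 : `|2^-1 : R| < 1 by rewrite ger0_norm// invf_lt1// ltr1n.
have /cvgrPdist_le := cvg_geometric (s - 2 * b) half_lt1.
move=> /(_ _ e0)[k _ /(_ _ (leqnn k))]; rewrite sub0r normrN /= => small.
move: (f_iter k) => /lpball_pnormP/(_ A)/le_trans; apply.
by rewrite lerD2l (le_trans (ler_norm _)).
Qed.

(** * Descent *)

Section Descent.
Variables (R : realType) (p a : R).
Hypotheses (p_ge1 : 1 <= p) (a_ge0 : 0 <= a) (a_l1 : l1_embedded p (omega a)).
Variable T : (int -> R[i]) -> int -> R[i].
Hypothesis T_hom : alg_hom (lpw p (omega (a + 1))) (lpw p (omega (a + 1))) T.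
Hypothesis T_surj : forall h : int -> R[i], lpw p (omega (a + 1)) h ->
  exists2 f : int -> R[i], lpw p (omega (a + 1)) f & T f = h.
Implicit Types (f g q : int -> R[i]) (b s t e : R) (z : R[i]).

Let aS_ge0 : 0 <= a + 1. Proof. exact: addr_ge0. Qed.

Let aS_l1 : l1_embedded p (omega (a + 1)).
Proof.
have [C C0 fC] := a_l1; exists C => // s f fs; apply: fC.
by apply: lpball_omega_le fs => //; rewrite lerDl.
Qed.

Let T_lin : lin_on (lpw p (omega (a + 1))) T. Proof. by have [] := T_hom. Qed.

Let T_bounded : bounded_on (lpw p (omega (a + 1))) p (omega (a + 1)) (omega (a + 1)) T.
Proof. exact: alg_hom_omega_bounded. Qed.

Let lpw_fin b f : finsupp f -> lpw p (omega b) f.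
Proof. exact: (lpw_finsupp p_ge1 (omega_gt0 b)). Qed.

Let lpw_delta b n : lpw p (omega b) (delta n).
Proof. exact/lpw_fin/finsupp_delta. Qed.

Let T_delta0 : T (delta 0) = delta 0.
Proof.
have w_gt0 := @omega_gt0 R (a + 1).
exact: (alg_hom_delta0 p_ge1 w_gt0 w_gt0 T_hom aS_l1 T_surj).
Qed.

Let lpw_T b f : 0 <= b -> b <= a + 1 -> lpw p (omega (a + 1)) f -> lpw p (omega b) (T f).
Proof.
have [T_lpw _ _] := T_hom; move=> b0 ba /T_lpw[s Ts]; exists s.
exact: lpball_omega_le Ts.
Qed.

Let l1_T f : lpw p (omega (a + 1)) f -> l1 (T f).
Proof. by have [T_lpw _ _] := T_hom; move=> /T_lpw; exact: lpw_l1. Qed.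

Let l1_fderiv_T f : lpw p (omega (a + 1)) f -> l1 (fderiv (T f)).
Proof.
have [T_lpw _ _] := T_hom; move=> /T_lpw[s Ts]; apply: (lpw_l1 a_l1).
by exists s; exact: lpball_fderiv.
Qed.

Lemma chi_fderiv_alg_hom z : cmod z = 1 -> exists c : R[i], forall g, finsupp g ->
  chi z (fderiv (T g)) = c * chi z (T (fderiv g)).
Proof.
move=> z1; have [_ _ T_conv] := T_hom.
have [|m n|m n|c cE] := @int_character_derivation _ (fun n => chi z (T (delta n)))
    (fun n => chi z (fderiv (T (delta n)))).
- by rewrite T_delta0 chi_delta expr0z.
- by rewrite deltaD T_conv// chi_conv//; exact: l1_T.
- have [Tm Tn] := (l1_T (lpw_delta (a + 1) m), l1_T (lpw_delta (a + 1) n)).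
  have DTm := l1_fderiv_T (lpw_delta (a + 1) m).
  have DTn := l1_fderiv_T (lpw_delta (a + 1) n).
  rewrite deltaD T_conv// fderiv_conv// -[conv (fderiv _) _]mul1_fun chiZD//.
  - by rewrite mul1r !chi_conv.
  - exact: l1_conv.
  - exact: l1_conv.
exists c; apply: finsupp_ind => [|d n g fin_g IHg].
  rewrite fderiv0 !(lin_on0 T_lin) ?fderiv0 ?chi0 ?mulr0//.
  exact: lpw_fin (finsupp0 _ _).
have mg := lpw_fin (a + 1) fin_g.
have mDg := lpw_fin (a + 1) (finsupp_fderiv fin_g).
have mDn := lpw_fin (a + 1) (finsupp_fderiv (finsupp_delta R n)).
rewrite fderiv_lin !T_lin// !fderiv_lin !chiZD//; try exact: l1_T; try exact: l1_fderiv_T.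
rewrite IHg cE fderiv_delta (lin_onZ T_lin _ (lpw0 _ p_ge1))// chiZ//; last exact: l1_T.
by rewrite mulrDr mulrCA.
Qed.

Lemma conv_fderiv_alg_hom f g : finsupp f -> finsupp g ->
  conv (T (fderiv f)) (fderiv (T g)) = conv (fderiv (T f)) (T (fderiv g)).
Proof.
move=> fin_f fin_g.
have mf := lpw_fin (a + 1) fin_f; have mg := lpw_fin (a + 1) fin_g.
have mDf := lpw_fin (a + 1) (finsupp_fderiv fin_f).
have mDg := lpw_fin (a + 1) (finsupp_fderiv fin_g).
have [lTDf lTDg] := (l1_T mDf, l1_T mDg).
have [lDTf lDTg] := (l1_fderiv_T mf, l1_fderiv_T mg).
apply: chi_inj => [||z z1]; try exact: l1_conv.
rewrite !chi_conv//; have [c chiD] := chi_fderiv_alg_hom z1.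
by rewrite !chiD//; ring.
Qed.

(* [D (T psi) = delta 1] for the preimage [psi] of [delta 1]. *)
Lemma delta1_fderiv_approx e : 0 < e ->
  exists2 q, finsupp q & lpball p (omega a) e (delta 1 - fderiv (T q)).
Proof.
move=> e0; have [psi mpsi Tpsi] := T_surj (lpw_delta _ 1).
have [C C0 TC] := T_bounded; have C1 : 0 < C + 1 by rewrite ltr_wpDl.
have [q fin_q psi_q] := finsupp_dense p_ge1 (omega_gt0 _) mpsi (divr_gt0 e0 C1).
have mq := lpw_fin (a + 1) fin_q; exists q => //.
have -> : delta 1 = fderiv (T psi).
  by rewrite Tpsi fderiv_delta mul1_fun.
rewrite -fderivB -(lin_onB T_lin)//; apply: lpball_fderiv => //.
apply: lpball_le (TC _ _ (lpwB p_ge1 (omega_gt0 _) mpsi mq) psi_q).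
by rewrite ler_mul_divD1 ?(ltW e0).
Qed.

Section Step.
Variable b : R.
Hypotheses (b_ge0 : 0 <= b) (b_le_a : b <= a).
Hypothesis b_l1 : b = 0 \/ l1_embedded p (omega b).

Lemma lpball_conv_omega : exists2 C, 0 <= C & forall f g s t,
  lpball p (omega a) s f -> lpball p (omega b) t g ->
  lpball p (omega b) (C * s * t) (conv f g).
Proof.
have [C C0 fC] := a_l1; case: b_l1 => [b0|[D D0 gD]].
  by exists C => // f g s t /fC fs; rewrite b0 omega0; exact: lpball_conv_l1.
exists (2 `^ b * (D + C)) => [|f g s t fs gt].
  by rewrite mulr_ge0 ?addr_ge0 ?powR_ge0.
have := lpball_conv p_ge1 (omega_gt0 b) (powR_ge0 2 b) (fun m n => omegaD_le m n b_ge0)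
  (lpball_omega_le p_ge1 b_ge0 b_le_a fs) (fC _ _ fs) gt (gD _ _ gt).
by congr lpball; ring.
Qed.

(* Convolving [T (D g)] with [delta 1], a shift, amounts to convolving it with some
   [D (T q)], which can be exchanged for a bounded operation on [D (T g)]; the error
   of the approximation is absorbed. *)
Lemma alg_hom_fderiv_bounded :
  bounded_on finsupp p (omega (b + 1)) (omega (b + 1)) T ->
  bounded_on finsupp p (omega (b + 1)) (omega b) (T \o fderiv).
Proof.
move=> [C C0 TC]; have [M M0 convM] := lpball_conv_omega.
pose S : R := 2 `^ b * 2; have S0 : 0 <= S by rewrite mulr_ge0 ?powR_ge0.
have SM1 : 0 < 2 * (S * M) + 1 by rewrite ltr_wpDl ?mulr_ge0.
have [q fin_q q_near] := delta1_fderiv_approx (divr_gt0 ltr01 SM1).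
set e := 1 / _ in q_near; set r := delta 1 - _ in q_near.
have SMe : S * M * e <= 2^-1.
  by rewrite /e div1r ler_pdivrMr//; lra.
have mDq := lpw_fin (a + 1) (finsupp_fderiv fin_q).
have [X Tq_ball] : lpw p (omega a) (T (fderiv q)) by apply: lpw_T; rewrite // lerDl.
have X0 := lpball_ge0 Tq_ball.
exists (2 * (S * (M * X * C))) => [|g s fin_g gs]; first by rewrite !mulr_ge0.
set h := T (fderiv g).
have mg := lpw_fin (a + 1) fin_g.
have mDg := lpw_fin (a + 1) (finsupp_fderiv fin_g).
rewrite -mulrA; apply: lpball_absorb => [|t ht].
  by apply: lpw_T => //; rewrite (le_trans b_le_a)// lerDl.
have := convM _ _ _ _ Tq_ball (lpball_fderiv p_ge1 b_ge0 (TC _ _ fin_g gs)).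
rewrite (conv_fderiv_alg_hom fin_q fin_g) => main_ball.
have split_shift : conv (delta 1) h = conv (fderiv (T q)) h + conv r h.
  have h_le n : cmod (h n) <= t by exact: (lpball_cmod_le n p_ge1 (omega_ge1 b) ht).
  have lr : l1 r by apply: (lpw_l1 a_l1); exists e.
  have := conv_linl 1 (l1_fderiv_T (lpw_fin (a + 1) fin_q)) lr h_le.
  by rewrite !mul1_fun /r addrC subrK.
have := lpballD p_ge1 (omega_gt0 b) main_ball (convM _ _ _ _ q_near ht).
rewrite -split_shift => /(lpball_conv_delta1 p_ge1 b_ge0); apply: lpball_le.
have := ler_wpM2r (lpball_ge0 ht) SMe; rewrite -/S; lra.
Qed.

Lemma alg_hom_descent : bounded_on finsupp p (omega (b + 1)) (omega (b + 1)) T ->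
  bounded_on finsupp p (omega b) (omega b) T.
Proof.
move=> /alg_hom_fderiv_bounded[K K0 TDK].
have [t Tt] : lpw p (omega b) (T (delta 0)).
  by apply: lpw_T => //; rewrite (le_trans b_le_a)// lerDl.
have t0 := lpball_ge0 Tt.
exists (t + K) => [|f s fin_f fs]; first exact: addr_ge0.
have fin_If := finsupp_fint fin_f.
rewrite [f]fintK T_lin//; last exact/lpw_fin/finsupp_fderiv.
have := lpballD p_ge1 (omega_gt0 b) (lpballZ p_ge1 (omega_gt0 b) (f 0) Tt)
  (TDK _ _ fin_If (lpball_fint p_ge1 b_ge0 fs)).
apply: lpball_le; rewrite mulrDl lerD2r mulrC ler_wpM2l//.
exact: (lpball_cmod_le 0 p_ge1 (omega_ge1 b) fs).
Qed.

End Step.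

End Descent.

(** * Extension to l^p *)

Section AlgebraIsomorphisms.
Variables (R : realType) (p : R).
Hypothesis p_ge1 : 1 <= p.
Implicit Types (S T : (int -> R[i]) -> int -> R[i]).

Let one_gt0 (n : int) : 0 < (1 : R). Proof. exact: ltr01. Qed.

#[local] Notation lp := (lpw p (fun=> 1)).

Lemma alg_iso_lpw_alg_hom a T : alg_iso_lpw p a T ->
  alg_hom (lpw p (omega a)) (lpw p (omega a)) T.
Proof. by rewrite /alg_iso_lpw in_lpwE// => -[]. Qed.

Lemma alg_iso_lpw_surj a T : alg_iso_lpw p a T -> forall h : int -> R[i],
  lpw p (omega a) h -> exists2 f : int -> R[i], lpw p (omega a) f & T f = h.
Proof. by rewrite /alg_iso_lpw in_lpwE// => -[]. Qed.

Lemma alg_iso_lpw_inverse a T : 0 <= a -> l1_embedded p (omega a) ->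
  alg_iso_lpw p a T -> exists T', [/\ alg_iso_lpw p a T',
    forall f, in_lpw p a f -> T' (T f) = f & forall f, in_lpw p a f -> T (T' f) = f].
Proof.
rewrite /alg_iso_lpw in_lpwE// => a0 a_l1 [T_lpw T_lin T_conv T_inj T_surj].
have /choice[T' TT'] h : exists f, lpw p (omega a) h -> lpw p (omega a) f /\ T f = h.
  have [mh|nh] := pselect (lpw p (omega a) h); last by exists 0 => /nh.
  by have [f mf Tf] := T_surj h mh; exists f.
have T'_lpw h : lpw p (omega a) h -> lpw p (omega a) (T' h) by move=> /TT'[].
have T'K h : lpw p (omega a) h -> T (T' h) = h by move=> /TT'[].
have TK f : lpw p (omega a) f -> T' (T f) = f.
  by move=> mf; apply: T_inj; rewrite ?T'K//; [exact/T'_lpw/T_lpw|exact: T_lpw].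
have w_gt0 := @omega_gt0 R a.
have lpw_convw := lpw_conv p_ge1 w_gt0 (omega_weakly_subadditive a0) a_l1.
exists T'; split=> //; split=> // [c f g mf mg|f g mf mg|f g mf mg Tfg|f mf].
- have T'cfg := lpwZD p_ge1 w_gt0 c (T'_lpw f mf) (T'_lpw g mg).
  by rewrite -[RHS](TK _ T'cfg) T_lin ?T'K//; exact: T'_lpw.
- rewrite -[RHS]TK ?T_conv ?T'K//; try exact: T'_lpw.
  by apply: lpw_convw; exact: T'_lpw.
- by rewrite -(T'K f mf) Tfg T'K.
- by exists (T f); [exact: T_lpw|exact: TK].
Qed.

Lemma l1_embedded_omega_nat (j : nat) : p = 1 \/ (0 < j)%N ->
  l1_embedded p (omega j%:R).
Proof.
have [->|p1] := eqVneq p 1; first by move=> _; exact: l1_embedded_p1 (omega_ge1 _).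
move=> [p_eq1|j0]; first by rewrite p_eq1 eqxx in p1.
have p_gt0 : 0 < p by exact: lt_le_trans ltr01 p_ge1.
apply: l1_embedded_omega; first by rewrite lt_def p1.
by rewrite (@lt_le_trans _ _ 1) ?ler1n// gtrBl invr_gt0.
Qed.

Section Extension.
Variable k : nat.
Hypothesis k_or_p1 : p = 1 \/ (0 < k)%N.

Let kS_l1 : l1_embedded p (omega k.+1%:R).
Proof. by apply: l1_embedded_omega_nat; right. Qed.

Lemma alg_iso_lpw_finsupp_bounded T : alg_iso_lpw p k.+1%:R T ->
  bounded_on finsupp p (fun=> 1) (fun=> 1) T.
Proof.
move=> T_iso; have T_hom := alg_iso_lpw_alg_hom T_iso.
have T_surj := alg_iso_lpw_surj T_iso.
suff bdd i : (i <= k.+1)%N ->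
    bounded_on finsupp p (omega (k.+1 - i)%:R) (omega (k.+1 - i)%:R) T.
  by have := bdd k.+1 (leqnn _); rewrite subnn omega0.
elim: i => [_|i IHi i_lt].
  have T_bdd := alg_hom_omega_bounded p_ge1 (ler0n _ _) kS_l1 T_hom.
  rewrite subn0; apply: bounded_on_sub T_bdd => // f.
  exact: (lpw_finsupp p_ge1 (omega_gt0 _)).
move: T_hom T_surj; rewrite -[k.+1%:R]natr1 subSS => T_hom T_surj.
apply: (alg_hom_descent p_ge1 _ (l1_embedded_omega_nat k_or_p1) T_hom T_surj) => //.
- by rewrite ler_nat leq_subr.
- have [->|ki] := posnP (k - i)%N; first by left.
  by right; apply: l1_embedded_omega_nat; right.
- by rewrite natr1 -subSn//; exact/IHi/ltnW.
Qed.

Lemma alg_iso_lpw_extension T : alg_iso_lpw p k.+1%:R T -> exists S,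
  [/\ forall f, in_lpw p k.+1%:R f -> S f = T f, lin_on lp S &
    bounded_on lp p (fun=> 1) (fun=> 1) S].
Proof.
move=> T_iso; have T_hom := alg_iso_lpw_alg_hom T_iso.
have [T_lpw T_lin _] := T_hom.
have w_gt0 := @omega_gt0 R k.+1%:R.
have ball_le s (f : int -> R[i]) : lpball p (omega k.+1%:R) s f -> lpball p (fun=> 1) s f.
  by rewrite -omega0; exact: lpball_omega_le.
have lpw_le f : lpw p (omega k.+1%:R) f -> lp f by move=> [s /ball_le]; exists s.
have lpw_fin (f : int -> R[i]) : finsupp f -> lpw p (omega k.+1%:R) f.
  exact: (lpw_finsupp p_ge1 w_gt0).
have [S [ST S_lin S_bdd]] := bounded_lin_extension p_ge1 one_gt0 one_gt0
  (lin_on_sub lpw_fin T_lin) (alg_iso_lpw_finsupp_bounded T_iso).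
exists S; split=> //; rewrite in_lpwE//.
apply: (eq_bounded_lin p_ge1 w_gt0 one_gt0) ST => //.
- exact: lin_on_sub S_lin.
- exact: bounded_on_sub S_bdd.
- have T_bdd := alg_hom_omega_bounded p_ge1 (ler0n _ _) kS_l1 T_hom.
  exact: bounded_on_sub T_bdd.
Qed.

Lemma extension_cancel T T' S S' :
  (forall f, in_lpw p k.+1%:R f -> in_lpw p k.+1%:R (T f)) ->
  (forall f, in_lpw p k.+1%:R f -> T' (T f) = f) ->
  (forall f, in_lpw p k.+1%:R f -> S f = T f) ->
  (forall f, in_lpw p k.+1%:R f -> S' f = T' f) ->
  lin_on lp S -> bounded_on lp p (fun=> 1) (fun=> 1) S ->
  lin_on lp S' -> bounded_on lp p (fun=> 1) (fun=> 1) S' ->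
  forall f, lp f -> S' (S f) = f.
Proof.
move=> T_lpw TK ST S'T' S_lin S_bdd S'_lin S'_bdd.
have S_lp f : lp f -> lp (S f) := bounded_on_lpw S_bdd.
apply: (@eq_bounded_lin _ _ _ _ _ _ p_ge1 one_gt0 one_gt0 (S' \o S) id).
- exact: lin_on_comp S_lp S'_lin S_lin.
- exact: bounded_on_comp S_lp S'_bdd S_bdd.
- by [].
- by exists 1 => // f s _; rewrite mul1r.
move=> f fin_f; have mf : in_lpw p k.+1%:R f.
  by rewrite in_lpwE//; exact: (lpw_finsupp p_ge1 (omega_gt0 _)).
by rewrite /= ST// S'T' ?TK//; exact: T_lpw.
Qed.

End Extension.

Lemma lin_iso_lp_inverse S S' : lin_on lp S ->
  bounded_on lp p (fun=> 1) (fun=> 1) S -> bounded_on lp p (fun=> 1) (fun=> 1) S' ->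
  (forall f, lp f -> S' (S f) = f) -> (forall f, lp f -> S (S' f) = f) ->
  lin_iso_lp p S.
Proof.
rewrite -(in_lpE p_ge1) => S_lin S_bdd S'_bdd SK S'K.
have lp_map U : bounded_on (in_lp p) p (fun=> 1) (fun=> 1) U ->
    forall f, in_lp p f -> in_lp p (U f).
  by rewrite in_lpE// => U_bdd f; exact: (bounded_on_lpw U_bdd).
have lp_norm_bounded U : bounded_on (in_lp p) p (fun=> 1) (fun=> 1) U ->
    exists C, forall f, in_lp p f -> lp_norm p (U f) <= C * lp_norm p f.
  move=> [C _ UC]; exists C => f mf; apply: (lp_norm_le p_ge1).
  exact/UC/lpball_lp_norm.
split=> [||||]; [exact: lp_map|exact: S_lin|exact: lp_norm_bounded|..].
- by move=> f g mf mg Sfg; rewrite -(SK f mf) Sfg SK.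
split=> [h mh|]; first by exists (S' h); [exact: lp_map|exact: S'K].
have [C SC] := lp_norm_bounded S' S'_bdd; exists C => f mf.
by rewrite -{1}(SK f mf); apply: SC; exact: lp_map.
Qed.

End AlgebraIsomorphisms.

Theorem theorem3p1 (R : realType) (a : int) (p : R)
  (hp : 1 <= p)
  (hap : ((1 <= a)%R /\ p = 1) \/ ((2 <= a)%R /\ 1 < p))
  (T : (int -> R[i]) -> (int -> R[i]))
  (hT : alg_iso_lpw p (a%:~R) T) :
  exists S : (int -> R[i]) -> (int -> R[i]),
    (forall f, in_lpw p (a%:~R) f -> S f = T f) /\ lin_iso_lp p S.
Proof.
have [k ak k_or_p1] : exists2 k : nat, a = k.+1 & p = 1 \/ (0 < k)%N.
  exists `|a|.-1%N; first by case: hap => -[a1 _]; lia.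
  by case: hap => -[a1 p1]; [left|right; lia].
move: hT; rewrite {}ak -[k.+1%:~R]/(k.+1%:R) => T_iso.
have a_l1 := l1_embedded_omega_nat hp (or_intror (ltn0Sn k)).
have [T' [T'_iso TK T'K]] := alg_iso_lpw_inverse hp (ler0n _ _) a_l1 T_iso.
have [S [ST S_lin S_bdd]] := alg_iso_lpw_extension hp k_or_p1 T_iso.
have [S' [S'T' S'_lin S'_bdd]] := alg_iso_lpw_extension hp k_or_p1 T'_iso.
exists S; split=> //; apply: (lin_iso_lp_inverse hp S_lin S_bdd S'_bdd).
- by have [T_lpw _ _ _ _] := T_iso; exact: extension_cancel T_lpw TK ST S'T' _ _ _ _.
- by have [T'_lpw _ _ _ _] := T'_iso; exact: extension_cancel T'_lpw T'K S'T' ST _ _ _ _.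
Qed.
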